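(* There is a universal sequence $\mathbf{C}=(C_r)_{r\ge1}$ of positive real numbers such that the following holds. For any $n\ge1$ and any integer partition $\lambda$ of $n$, the complete graph $L$ on vertex set $[n]^2$ with edge weights $$w\big((i,j),(k,\ell)\big)=\begin{cases}\frac1n & \text{if } \{i,j\}\text{ and }\{k,\ell\}\text{ are disjoint;}\\ 1&\text{otherwise,}\end{cases}$$ is a $(\Psi,\mathbf{C})$ weighted dependency graph for the family $\{B_{i,j},\ (i,j)\in[n]^2\}$, where $B_{i,j}=\mathbf{1}[\sigma_\lambda(i)=j]$ and $\sigma_\lambda$ is a uniform random permutation of $[n]$ of cycle type $\lambda$.
   Context: Notation: $[n]=\{1,\dots,n\}$. Mixed cumulants: for random variables $X_1,\dots,X_r$ with finite moments on a common probability space, $\kappa(X_1,\dots,X_r)=[t_1\cdots t_r]\log\mathbb{E}[\exp(t_1X_1+\cdots+t_rX_r)]$ (coefficient of $t_1\cdots t_r$ in the formal power series). Maximal spanning tree weight: a weighted graph has edge weights in $(0,1]$ (non-edges being regarded as edges of weight $0$). For a weighted graph $H$, $\mathcal{M}(H)$ is the maximal weight of a spanning tree of $H$, the weight of a spanning tree being the product of the weights of its edges (equal to $1$ if $H$ has a single vertex; $\mathcal{M}(H)=0$ if $H$ is disconnected). Weighted dependency graph: let $V$ be a finite set, $\{Y_v,v\in V\}$ random variables with finite moments on the same probability space, $\mathbf{C}=(C_1,C_2,\dots)$ a sequence of positive reals and $\Psi$ a real-valued function on multisets of elements of $V$. A weighted graph $L$ with vertex set $V$ is a $(\Psi,\mathbf{C})$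 weighted dependency graph for $\{Y_v,v\in V\}$ if for any multiset $U=\{v_1,\dots,v_r\}$ of elements of $V$, $$\big|\kappa(Y_v;v\in U)\big|\le C_r\,\Psi(U)\,\mathcal{M}(L[U]),$$ where $L[U]$ is the weighted graph with vertex set $U$ (elements taken with multiplicity) and the same weights as $L$; here two copies of the same element $(i,j)$ are joined by an edge of weight $1$, in accordance with the formula for $w$. The function $\Psi$: for a subset, list or multiset $\alpha=\{(i_t,j_t),t\le T\}$ of elements of $[n]^2$, let $S(\alpha)=\{i_1,\dots,i_T,j_1,\dots,j_T\}$ and let $\mathrm{CC}(\alpha)$ be the number of connected components of the graph with vertex set $S(\alpha)$ and edge set $\alpha$ (each pair $(i_t,j_t)$ is an edge between $i_t$ and $j_t$, a loop if $i_t=j_t$). Then $\Psi(\alpha)=n^{\mathrm{CC}(\alpha)-\#S(\alpha)}$, where $\#$ denotes the number of distinct elements. *)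

(* Defs.v *)
From HB Require Import structures.
From mathcomp Require Import all_boot all_order all_algebra all_fingroup.
From mathcomp Require Import finmap multiset.
From mathcomp Require Import all_classical all_reals all_analysis.

Set Implicit Arguments.
Unset Strict Implicit.
Unset Printing Implicit Defensive.
Import Order.TTheory GRing.Theory Num.Theory.

Local Open Scope ring_scope.
Local Open Scope classical_set_scope.

(* Formal power series in the variables t_i (i < r): the series f has
   coefficient f m at the monomial prod_i t_i ^ (m i). *)
Definition mindex (r : nat) : Type := {ffun 'I_r -> nat}.

Definition mdegree (r : nat) (m : mindex r) : nat := (\sum_i m i)%N.

Definition fps (R : realType) (r : nat) : Type := mindex r -> R.

Section FormalPowerSeries.
Variables (R : realType) (r : nat).
Implicit Types (f g : fps R r) (m : mindex r).

Definition fps_one : fps R r := fun m => (mdegree m == 0%N)%:R.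

(* Cauchy product; a ranges over all multi-indices with a <= m pointwise
   (their entries are at most mdegree m). *)
Definition fps_mul f g : fps R r := fun m =>
  \sum_(a : {ffun 'I_r -> 'I_(mdegree m).+1} | [forall i, (a i <= m i)%N])
     f [ffun i => nat_of_ord (a i)] * g [ffun i => (m i - a i)%N].

Definition fps_pow f (k : nat) : fps R r := iter k (fps_mul f) fps_one.

(* The linear form sum_i x_i t_i. *)
Definition fps_lin (x : 'I_r -> R) : fps R r := fun m =>
  \sum_(i < r) (m == [ffun j => nat_of_bool (j == i)])%:R * x i.

(* exp f = sum_(k >= 0) f ^ k / k!, for f with zero constant coefficient:
   then the terms with k > mdegree m do not contribute to the coefficient
   at m. *)
Definition fps_exp f : fps R r := fun m =>
  \sum_(0 <= k < (mdegree m).+1) fps_pow f k m / (k`!)%:R.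

(* log g = sum_(k >= 1) (-1)^(k-1) (g - 1)^k / k, for g with constant
   coefficient 1: again the terms with k > mdegree m do not contribute. *)
Definition fps_log g : fps R r := fun m =>
  \sum_(1 <= k < (mdegree m).+1)
     (-1) ^+ k.-1 / k%:R * fps_pow (fun m' => g m' - fps_one m') k m.

End FormalPowerSeries.

Section Cumulants.
Context (d : measure_display) (T : measurableType d) (R : realType).
Variable P : probability T R.

Definition finite_moments (X : T -> R) : Prop :=
  measurable_fun setT X /\
  forall k : nat, P.-integrable setT (fun t => (X t ^+ k)%:E).

(* E[exp(sum_i t_i X_i)], the expectation being taken coefficientwise. *)
Definition moment_series (r : nat) (X : 'I_r -> T -> R) : fps R r :=
  fun m => fine ('E_P[fun t => fps_exp (fps_lin (fun i => X i t)) m])%E.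

(* The coefficient of prod_i t_i in the logarithm. *)
Definition cumulant (r : nat) (X : 'I_r -> T -> R) : R :=
  fps_log (moment_series X) [ffun=> 1%N].

End Cumulants.

(* A weighted graph is given by its weights, non-edges having weight 0.  The
   diagonal weight w v v is only used to join two copies of v in an induced
   graph (see wg_induced). *)
Definition weighted_graph (R : realType) (V : finType) (w : V -> V -> R) :
    Prop :=
  (forall u v, w u v = w v u) /\ (forall u v, 0 <= w u v <= 1).

Section SpanningTrees.
Variable r : nat.

(* An edge {a, b} is represented by the pair (a, b) with a < b. *)
Definition edge_rel (E : {set 'I_r * 'I_r}) : rel 'I_r :=
  fun a b => ((a, b) \in E) || ((b, a) \in E).

Definition spanning_tree (E : {set 'I_r * 'I_r}) : Prop :=
  [/\ forall p, p \in E -> (p.1 < p.2)%N,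
      forall a b, connect (edge_rel E) a b
    & forall c : seq 'I_r, ucycle (edge_rel E) c -> (size c <= 2)%N].

(* Spanning trees of the complete graph are allowed: those that use a
   non-edge of H have weight 0. *)
Definition max_tree_weight (R : realType) (H : 'I_r -> 'I_r -> R) : R :=
  \big[Num.max/0]_(E : {set 'I_r * 'I_r} | `[< spanning_tree E >])
     \prod_(p in E) H p.1 p.2.

End SpanningTrees.

(* The weighted graph induced on a multiset, listed as v_0, ..., v_(r-1). *)
Definition wg_induced (R : realType) (V : finType) (w : V -> V -> R)
    (r : nat) (v : r.-tuple V) : 'I_r -> 'I_r -> R :=
  fun a b => w (tnth v a) (tnth v b).

(* A (nonempty) multiset of size r is given by any listing v of its elements
   with multiplicity; C is used at indices r >= 1 only. *)
Definition weighted_dependency_graph (d : measure_display)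
    (T : measurableType d) (R : realType) (P : probability T R) (V : finType)
    (Psi : {mset V}%mset -> R) (C : nat -> R) (Y : V -> T -> R)
    (w : V -> V -> R) : Prop :=
  [/\ weighted_graph w,
      forall v, finite_moments P (Y v)
    & forall (r : nat) (v : r.-tuple V), (0 < r)%N ->
        `| cumulant P (fun a : 'I_r => Y (tnth v a)) |
          <= C r * Psi (seq_mset v) * max_tree_weight (wg_induced w v)].

Section PairGraph.
Variable n : nat.
Implicit Type alpha : {mset 'I_n * 'I_n}%mset.

Definition pair_rel alpha : rel 'I_n :=
  fun i j => ((i, j) \in alpha) || ((j, i) \in alpha).

Definition support_pts alpha : {set 'I_n} :=
  [set i | [exists j, pair_rel alpha i j]]%SET.

Definition CC alpha : nat := n_comp (pair_rel alpha) (support_pts alpha).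

Definition Psi (R : realType) alpha : R :=
  n%:R ^ ((CC alpha)%:Z - #|support_pts alpha|%:Z).

Definition perm_weight (R : realType) (u v : 'I_n * 'I_n) : R :=
  if [disjoint [set u.1; u.2]%SET & [set v.1; v.2]%SET] then n%:R^-1 else 1.

End PairGraph.

Definition is_partition (n : nat) (lambda : seq nat) : Prop :=
  [/\ sorted geq lambda, all (fun k => 0 < k)%N lambda & sumn lambda = n].

(* porbits s contains the fixed points of s as cycles of length 1. *)
Definition has_cycle_type (n : nat) (lambda : seq nat) (s : {perm 'I_n}) :
    bool :=
  perm_eq [seq #|pred_of_set c| | c <- enum (porbits s)] lambda.

Definition uniform_on (d : measure_display) (T : measurableType d)
    (R : realType) (P : probability T R) (F : finType) (A : {set F})
    (X : T -> F) : Prop :=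
  forall x : F, measurable (X @^-1` [set x]) /\
    P (X @^-1` [set x]) = (if x \in A then #|A|%:R^-1 else 0)%:E.

Definition perm_indicator (T : Type) (R : realType) (n : nat)
    (sigma : T -> {perm 'I_n}) (ij : 'I_n * 'I_n) : T -> R :=
  fun t => (sigma t ij.1 == ij.2)%:R.

(* Main.v *)
From HB Require Import structures.
Require Import Defs.
From mathcomp Require Import all_boot all_order all_algebra all_fingroup.
From mathcomp Require Import finmap multiset.
From mathcomp Require Import all_classical all_reals all_analysis.
From mathcomp Require Import ring zify.

Import Order.TTheory GRing.Theory Num.Theory.
Local Open Scope ring_scope.

Set Implicit Arguments.
Unset Strict Implicit.
Unset Printing Implicit Defensive.

(** Let S be the set of points that occur in the r given pairs.  The pairs
    that share a point are joined by edges of weight 1, so the components of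
    this graph on the pairs correspond to those of the graph on S, and some
    spanning tree of the pairs has at most CC - 1 edges of weight 1/n.
    Multiplied by n^(CC - #S) this gives at least n^(1 - #S)
    ([Psi_tree_weight_ge]), and the theorem becomes the estimate
    |cumulant| <= C_r n^(1 - #S) for the entries of the permutation matrix
    ([entry_cumulants_bound]).

    The estimate is proved by induction on r and, for given r, on #S.  Joint
    cumulants are multilinear, those involving a constant vanish, and the
    cumulant of x y, z_1, ..., z_k is that of x, y, z_1, ..., z_k plus a sum of
    products of two cumulants of smaller order ([cumM]).

    If two of the pairs lie in the same row or column, the product of the two
    entries is 0, or one of them, and [cumM] expresses the cumulant by
    cumulants of smaller order.  In each product the two factors have a point
    in common, which makes up for the factor n lost when two bounds of order
    n^(1 - a) and n^(1 - b) are multiplied ([entry_cum_shared]).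

    Otherwise the pairs form disjoint paths and cycles.  Let t be the end point
    of a path or, if there is no path, the list of points of a cycle; the other
    pairs avoid t.  Sum the product of the entries that involve t over all
    values of t: the result is a row sum, equal to 1, or the number of fixed
    points of a power of the permutation, which is constant on the conjugacy
    class.  Hence the cumulants of the product with the other entries add up
    to 0, or to that constant if there are no other entries.  The values of t that are distinct and new all give the same
    cumulant, by invariance under conjugation, and there are about n^k of them,
    k being the length of t; every other value gives a cumulant with fewer
    points, which the induction bounds, and these bounds add up to
    O(n^(1 - #S + k)) ([entry_cum_by_summation]).  Replacing the product of
    entries by the separate entries costs products of cumulants of smaller
    order ([cum_prod_linked]).

    The definition of the cumulants as coefficients of a logarithm enters
    through one identity: d (log g) g = d g, read on squarefree monomials, is
    the recursion that determines cumulants from moments ([conv_log_rec]). *)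

(** * Joint cumulants of lists of random variables *)

Section Splits.
Variable T : eqType.
Implicit Types l : seq T.

(** The ordered partitions of a list in two blocks.  A function of lists stands
    for an exponential generating function in several variables: sums over
    [splits l] are products, and [fun l => f (x :: l)] is a derivative of f. *)
Fixpoint splits l : seq (seq T * seq T) :=
  if l is z :: l' then
    [seq (z :: p.1, p.2) | p <- splits l'] ++ [seq (p.1, z :: p.2) | p <- splits l']
  else [:: ([::], [::])].

Lemma splits_cons z l : splits (z :: l) =
  [seq (z :: p.1, p.2) | p <- splits l] ++ [seq (p.1, z :: p.2) | p <- splits l].
Proof. by []. Qed.

Lemma splits_nil : splits [::] = [:: ([::], [::])]. Proof. by []. Qed.

#[local] Arguments splits : simpl never.

Lemma size_splits l : size (splits l) = (2 ^ size l)%N.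
Proof. by elim: l => // z l IH; rewrite splits_cons size_cat !size_map IH expnS mul2n addnn. Qed.

Lemma mem_splits_perm l p : p \in splits l -> perm_eq (p.1 ++ p.2) l.
Proof.
elim: l p => [|z l IH] p; first by rewrite inE => /eqP->.
rewrite splits_cons mem_cat => /orP[] /mapP[q /IH hq -> /=]; first by rewrite perm_cons.
by rewrite -cat1s perm_catCA /= perm_cons.
Qed.

Lemma mem_splits_subseq l p : p \in splits l -> subseq p.1 l /\ subseq p.2 l.
Proof.
elim: l p => [|z l IH] p; first by rewrite inE => /eqP->.
rewrite splits_cons mem_cat => /orP[] /mapP[q /IH[h1 h2] ->]; split.
- by rewrite /= eqxx.
- exact: subseq_trans h2 (subseq_cons _ _).
- exact: subseq_trans h1 (subseq_cons _ _).
- by rewrite /= eqxx.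
Qed.

Variable R : pzRingType.
Implicit Types F : seq T -> seq T -> R.

Lemma big_splits_nil F : \sum_(p <- splits [::]) F p.1 p.2 = F [::] [::].
Proof. by rewrite splits_nil big_seq1. Qed.

Lemma big_splits_cons F z l :
  \sum_(p <- splits (z :: l)) F p.1 p.2 =
  \sum_(p <- splits l) (F (z :: p.1) p.2 + F p.1 (z :: p.2)).
Proof. by rewrite splits_cons big_cat !big_map /= big_split. Qed.

Lemma big_splitsC F l :
  \sum_(p <- splits l) F p.1 p.2 = \sum_(p <- splits l) F p.2 p.1.
Proof.
elim: l F => [|z l IH] F; first by rewrite big_splits_nil (big_splits_nil (fun a b => F b a)).
rewrite big_splits_cons (big_splits_cons (fun a b => F b a)) !big_split /= addrC.
by rewrite (IH (fun a b => F (z :: a) b)) (IH (fun a b => F a (z :: b))).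
Qed.

Lemma big_splitsA (F : seq T -> seq T -> seq T -> R) l :
  \sum_(p <- splits l) \sum_(q <- splits p.1) F q.1 q.2 p.2 =
  \sum_(p <- splits l) \sum_(q <- splits p.2) F p.1 q.1 q.2.
Proof.
elim: l F => [|z l IH] F; first by rewrite !big_seq1.
rewrite (big_splits_cons (fun a b => \sum_(q <- splits a) F q.1 q.2 b)).
rewrite (big_splits_cons (fun a b => \sum_(q <- splits b) F a q.1 q.2)).
under eq_bigr do rewrite (big_splits_cons (fun a c => F a c _)) big_split /=.
under [RHS]eq_bigr do rewrite (big_splits_cons (fun a c => F _ a c)) big_split /=.
rewrite !big_split /= (IH (fun a b c => F (z :: a) b c)).
rewrite (IH (fun a b c => F a (z :: b) c)) (IH (fun a b c => F a b (z :: c))).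
by rewrite addrA.
Qed.

Lemma big_splits_top F l :
  \sum_(p <- splits l) F p.1 p.2 =
  F l [::] + \sum_(p <- splits l | (size p.1 < size l)%N) F p.1 p.2.
Proof.
rewrite (bigID (fun p => (size p.1 < size l)%N)) /= addrC; congr (_ + _).
elim: l F => [|z l IH] F; first by rewrite big_mkcond big_seq1.
rewrite splits_cons big_cat !big_map /= [X in _ + X]big_seq_cond [X in _ + X]big1 ?addr0.
  rewrite -(IH (fun a b => F (z :: a) b)); apply: eq_bigl => p.
  by rewrite ltnS.
move=> p /andP[/mem_splits_subseq[/size_subseq h _]].
by rewrite ltnS h.
Qed.

Lemma big_splits_mid F a z b :
    (forall I I' J J', perm_eq I I' -> perm_eq J J' -> F I J = F I' J') ->
  \sum_(p <- splits (a ++ z :: b)) F p.1 p.2 =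
  \sum_(p <- splits (z :: a ++ b)) F p.1 p.2.
Proof.
elim: a F => // y a IH F HF; rewrite cat_cons big_splits_cons big_split /=.
rewrite (IH (fun I J => F (y :: I) J)); last first.
  by move=> I I' J J' h1 h2; apply: HF; rewrite ?perm_cons.
rewrite (IH (fun I J => F I (y :: J))); last first.
  by move=> I I' J J' h1 h2; apply: HF; rewrite ?perm_cons.
rewrite (big_splits_cons (fun I J => F (y :: I) J)).
rewrite (big_splits_cons (fun I J => F I (y :: J))) (big_splits_cons F).
rewrite !big_split /= (big_splits_cons (fun I J => F (z :: I) J)).
rewrite (big_splits_cons (fun I J => F I (z :: J))) !big_split /= !addrA.
have hs (u v : T) (w : seq T) : perm_eq (u :: v :: w) (v :: u :: w).
  by rewrite -[u :: _]cat1s -[v :: w]cat1s perm_catCA.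
under eq_bigr do rewrite (HF _ _ _ _ (hs _ _ _) (perm_refl _)).
under [X in _ + X]eq_bigr do rewrite (HF _ _ _ _ (perm_refl _) (hs _ _ _)).
by congr (_ + _); rewrite addrAC.
Qed.

Lemma big_splits_perm F l l' :
    (forall I I' J J', perm_eq I I' -> perm_eq J J' -> F I J = F I' J') ->
  perm_eq l l' -> \sum_(p <- splits l) F p.1 p.2 = \sum_(p <- splits l') F p.1 p.2.
Proof.
elim: l l' F => [|z l IH] l' F HF hl.
  by move: hl; rewrite perm_sym => /perm_nilP->.
have zl' : z \in l' by rewrite -(perm_mem hl) mem_head.
case: (splitPr zl') hl => a b hl.
rewrite big_splits_mid // !big_splits_cons !big_split /=.
have hl' : perm_eq l (a ++ b).
  by rewrite -(perm_cons z); apply: (perm_trans hl); rewrite -cat1s perm_catCA.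
rewrite (IH (a ++ b) (fun I J => F (z :: I) J)) //; last first.
  by move=> *; apply: HF; rewrite ?perm_cons.
rewrite (IH (a ++ b) (fun I J => F I (z :: J))) //.
by move=> *; apply: HF; rewrite ?perm_cons.
Qed.

End Splits.
#[global] Arguments splits : simpl never.

Lemma splits_map (T U : eqType) (f : T -> U) l :
  splits (map f l) = [seq (map f p.1, map f p.2) | p <- splits l].
Proof.
elim: l => // z l IH; rewrite map_cons !splits_cons IH map_cat -!map_comp.
by congr (_ ++ _); apply: eq_map => p.
Qed.

Section Cumulants.
Context {R : comPzRingType} {V : comPzRingType} (E : {additive V -> R}).
Hypothesis E1 : E 1 = 1.
Implicit Types (x y z : V) (l : seq V).

Definition mom l : R := E (\prod_(x <- l) x).

(** The equation [mom_cum] between moments and cumulants, solved for the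
    cumulant of highest order.  The argument k bounds the depth of the
    recursion, since p.1 is not a subterm of l. *)
Fixpoint cum_rec (k : nat) x l : R :=
  if k is k'.+1 then
    mom (x :: l) - \sum_(p <- splits l | (size p.1 < size l)%N) cum_rec k' x p.1 * mom p.2
  else mom (x :: l).

Definition cum x l : R := cum_rec (size l) x l.

Lemma mom_perm l l' : perm_eq l l' -> mom l = mom l'.
Proof. by move=> h; rewrite /mom (perm_big _ h). Qed.

Lemma mom_nil : mom [::] = 1.
Proof. by rewrite /mom big_nil. Qed.

Lemma cum_rec_fuel k x l : (size l <= k)%N -> cum_rec k x l = cum x l.
Proof.
rewrite /cum; elim: {l}(size l) {-2}l (leqnn (size l)) k => [|m IH] l hl k hk.
  move: hl; rewrite leqn0 => /nilP->; case: k {hk} => //= k.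
  by rewrite big_mkcond big_seq1 /= subr0.
case: (posnP (size l)) => [/eqP/nilP l0|].
  by apply: IH => //; rewrite l0.
case: k hk => [|k] hk; first by rewrite ltnNge hk.
case El: (size l) => [//|j] _ /=; congr (_ - _); apply: eq_bigr => p.
rewrite El ltnS => hp; congr (_ * _).
have hp' : (size p.1 <= m)%N by apply: leq_trans hp _; rewrite -ltnS -El.
have hk' : (size p.1 <= k)%N by apply: leq_trans hp _; rewrite -ltnS -El.
by rewrite (IH p.1 hp' k) // (IH p.1 hp' j).
Qed.

Lemma cumE x l :
  cum x l = mom (x :: l) -
    \sum_(p <- splits l | (size p.1 < size l)%N) cum x p.1 * mom p.2.
Proof.
rewrite -(@cum_rec_fuel (size l).+1) //=; congr (_ - _); apply: eq_bigr => p hp.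
by rewrite cum_rec_fuel // ltnW.
Qed.

Lemma mom_cum x l :
  mom (x :: l) = \sum_(p <- splits l) cum x p.1 * mom p.2.
Proof.
rewrite (big_splits_top (fun a b => cum x a * mom b)) mom_nil mulr1 cumE.
by rewrite addrNK.
Qed.

(** Convolution with the moments is injective because the empty moment is 1.
    Identities between cumulants are proved by convolving both sides with the
    moments, which turns them into identities between moments. *)
Lemma conv_mom_inj (G G' : seq V -> R) :
    (forall l, \sum_(p <- splits l) G p.1 * mom p.2 =
               \sum_(p <- splits l) G' p.1 * mom p.2) ->
  forall l, G l = G' l.
Proof.
move=> H l; elim: {l}(size l).+1 {-2}l (ltnSn (size l)) => // m IH l hl.
have := H l; rewrite (big_splits_top (fun a b => G a * mom b)).
rewrite (big_splits_top (fun a b => G' a * mom b)) mom_nil !mulr1.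
rewrite (eq_bigr (fun p => G' p.1 * mom p.2)) => [/addIr //|p hp].
by rewrite IH // (leq_trans hp).
Qed.

Lemma cumD x y l : cum (x + y) l = cum x l + cum y l.
Proof.
move: l; apply: conv_mom_inj => l; rewrite -mom_cum.
under eq_bigr do rewrite mulrDl.
by rewrite big_split /= -!mom_cum /mom !big_cons mulrDl raddfD.
Qed.

Lemma cum0 l : cum 0 l = 0.
Proof. by apply: (addIr (cum 0 l)); rewrite -cumD !add0r. Qed.

Lemma cum_sum (I : Type) (s : seq I) (x : I -> V) l :
  cum (\sum_(i <- s) x i) l = \sum_(i <- s) cum (x i) l.
Proof.
elim: s => [|i s IH]; first by rewrite !big_nil cum0.
by rewrite !big_cons cumD IH.
Qed.

(** In a partition of [x, y, l] the variables x and y are in the same block or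
    in two different ones; the partitions of [x * y, l] are those of the first
    kind, but the moments of both lists are the same. *)
Lemma cumM x y l :
  cum (x * y) l = cum x (y :: l) + \sum_(p <- splits l) cum x p.1 * cum y p.2.
Proof.
move: l; apply: conv_mom_inj => l; rewrite -mom_cum.
under eq_bigr do rewrite mulrDl big_distrl /=.
rewrite big_split /= (big_splitsA (fun a b c => cum x a * cum y b * mom c)).
have -> : mom (x * y :: l) = mom [:: x, y & l] by rewrite /mom !big_cons mulrA.
rewrite mom_cum.
rewrite (big_splits_cons (fun a b => cum x a * mom b)) big_split /=.
congr (_ + _); apply: eq_bigr => p _; rewrite mom_cum big_distrr /=.
by apply: eq_bigr => q _; rewrite mulrA.
Qed.

(** The terms other than these two in [cumM] are symmetric in x and y. *)
Lemma cum_swap x y l : cum x (y :: l) = cum y (x :: l).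
Proof.
have h := cumM x y l; have := cumM y x l; rewrite mulrC h => /esym.
rewrite (big_splitsC (fun a b => cum y a * cum x b)).
by under eq_bigr do rewrite mulrC; move/addIr.
Qed.

Lemma cum_perm_tail x l l' : perm_eq l l' -> cum x l = cum x l'.
Proof.
elim: {l}(size l).+1 {-2}l (ltnSn (size l)) l' => // m IH l hl l' h.
rewrite !cumE (mom_perm (l' := x :: l')) ?perm_cons //; congr (_ - _).
rewrite big_mkcond [RHS]big_mkcond (perm_size h) /=.
set N := size l'.
apply: (big_splits_perm (F := fun I J =>
   if (size I < N)%N then cum x I * mom J else 0)) => // I I' J J' hI hJ.
rewrite -(perm_size hI); case: ifP => // hs; rewrite (mom_perm hJ); congr (_ * _).
by apply: IH => //; apply: leq_trans hs _; rewrite /N -(perm_size h).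
Qed.

(** Constancy is expressed through E: a function that is constant on the
    support of E need not be a constant function. *)
Lemma cum_const x c l :
  (forall y, E (x * y) = c * E y) -> cum x l = if l is [::] then c else 0.
Proof.
move=> Hx; move: l; apply: conv_mom_inj => l; rewrite -mom_cum.
rewrite {1}/mom big_cons Hx -/(mom l).
rewrite (big_splitsC (fun a b => (if a is [::] then c else 0) * mom b)).
transitivity (\sum_(p <- splits l | p.2 == [::]) (c * mom p.1)); last first.
  by rewrite big_mkcond; apply: eq_bigr => -[a [|? ?]] _ //=; rewrite mul0r.
elim: l (mom) => [|z l IH] f; first by rewrite big_mkcond big_seq1.
rewrite splits_cons big_cat !big_map /= [X in _ + X]big_pred0 ?addr0 //.
by rewrite -(IH (fun l => f (z :: l))).
Qed.

End Cumulants.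

Section CumulantLabels.
Variables (R V V' : comPzRingType) (E : {additive V -> R}) (E' : {additive V' -> R}).
Variables (T : eqType) (f : T -> V) (g : T -> V').

Lemma eq_cum x l :
    (forall s, mom E (map f s) = mom E' (map g s)) ->
  cum E (f x) (map f l) = cum E' (g x) (map g l).
Proof.
move=> H; elim: {l}(size l).+1 {-2}l (ltnSn (size l)) => // m IH l hl.
rewrite !cumE -!map_cons H !splits_map !big_map; congr (_ - _).
apply: eq_big => p /=; rewrite !size_map // => hp.
by rewrite H IH // (leq_trans hp).
Qed.
End CumulantLabels.

Fixpoint cum_ub (k : nat) : nat :=
  if k is k'.+1 then (1 + 2 ^ k * cum_ub k')%N else 1%N.

Lemma cum_ub_mono : {homo cum_ub : k m / (k <= m)%N}.
Proof.
apply: (homo_leq (fun x => leqnn x) leq_trans) => k /=.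
by rewrite -[X in (X <= _)%N]mul1n (leq_trans _ (leq_addl _ _)) // leq_mul // expn_gt0.
Qed.

(** The bound depends on the order of the cumulant alone; this settles the
    values of n that are small compared with the order. *)
Lemma cum_bounded (R : numDomainType) (V : comPzRingType) (E : {additive V -> R})
    (T : eqType) (f : T -> V) x l :
    (forall s, `|mom E (map f s)| <= 1) ->
  `|cum E (f x) (map f l)| <= (cum_ub (size l))%:R.
Proof.
move=> H; elim: {l}(size l).+1 {-2}l (ltnSn (size l)) => // m IH l hl.
rewrite cumE -map_cons splits_map big_map size_map.
case: l hl => [|z l] hl.
  by rewrite big_mkcond big_seq1 /= subr0; exact: (H [:: x]).
rewrite [size _]/= [cum_ub _]/= natrD; apply: le_trans (ler_normB _ _) _.
apply: lerD; first exact: H.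
apply: le_trans (ler_norm_sum _ _ _) _.
apply: (@le_trans _ _ (\sum_(p <- splits (z :: l)) (cum_ub (size l))%:R)).
  rewrite big_mkcond /=; apply: ler_sum => p _; case: ifP => //=.
  rewrite size_map ltnS => hp; rewrite normrM -[leRHS]mulr1.
  apply: ler_pM => //; apply: le_trans (IH _ _) _; first exact: leq_ltn_trans hp hl.
  by rewrite ler_nat; apply: cum_ub_mono.
by rewrite big_const_seq count_predT iter_addr addr0 size_splits mulnC natrM mulr_natr.
Qed.

(** * The logarithm of a power series and the cumulant recursion *)

Section Convolution.
Variables (T : eqType) (R : numFieldType).
Implicit Types (f g h u : seq T -> R) (l : seq T) (x : T).

Definition conv f g l := \sum_(p <- splits l) f p.1 * g p.2.
Definition conv1 l : R := (l == [::])%:R.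
Definition conv_pow f k := iter k (conv f) conv1.
Arguments conv_pow : simpl never.

Lemma conv_powS f k : conv_pow f k.+1 = conv f (conv_pow f k).
Proof. by []. Qed.

Lemma convC f g : conv f g = conv g f.
Proof.
apply/funext => l; rewrite /conv (big_splitsC (fun a b => f a * g b)).
by apply: eq_bigr => p _; rewrite mulrC.
Qed.

Lemma convA f g h : conv (conv f g) h = conv f (conv g h).
Proof.
apply/funext => l; rewrite /conv.
under eq_bigr do rewrite big_distrl /=.
rewrite (big_splitsA (fun a b c => f a * g b * h c)); apply: eq_bigr => p _.
by rewrite big_distrr /=; apply: eq_bigr => q _; rewrite mulrA.
Qed.

Lemma convDr f g h l : conv f (g \+ h) l = conv f g l + conv f h l.
Proof. by rewrite /conv -big_split /=; apply: eq_bigr => p _; rewrite mulrDr. Qed.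

Lemma convZr f g (c : R) l : conv f (fun s => c * g s) l = c * conv f g l.
Proof. by rewrite /conv big_distrr; apply: eq_bigr => p _; rewrite mulrCA. Qed.

Lemma conv1r f : conv f conv1 = f.
Proof.
apply/funext => l; rewrite /conv (big_splitsC (fun a b => f a * conv1 b)) /conv1.
elim: l f => [|z l IH] f; first by rewrite big_seq1 mulr1.
rewrite (big_splits_cons (fun a b => f b * (a == [::])%:R)) -(IH (fun s => f (z :: s))).
by apply: eq_bigr => p _; rewrite mulr0 add0r.
Qed.

Lemma conv_cons f g x l :
  conv f g (x :: l) = conv (fun s => f (x :: s)) g l + conv f (fun s => g (x :: s)) l.
Proof. by rewrite /conv (big_splits_cons (fun a b => f a * g b)) big_split. Qed.

Lemma conv_pow_cons u k x l :
  conv_pow u k.+1 (x :: l) = k.+1%:R * conv (conv_pow u k) (fun s => u (x :: s)) l.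
Proof.
elim: k l => [|k IH] l.
  by rewrite /conv_pow /= conv1r mul1r convC conv1r.
rewrite conv_powS conv_cons.
rewrite (convC _ (conv_pow u k.+1)).
have -> : conv u (fun s => conv_pow u k.+1 (x :: s)) l =
          k.+1%:R * conv (conv_pow u k.+1) (fun s => u (x :: s)) l.
  transitivity (conv u (fun s => k.+1%:R * conv (conv_pow u k) (fun s => u (x :: s)) s) l).
    by congr (conv u _ l); apply/funext => s; exact: IH.
  by rewrite convZr -convA.
by rewrite [in RHS]mulrSr mulrDl mul1r addrC.
Qed.

Lemma conv_pow_small u k l : u [::] = 0 -> (size l < k)%N -> conv_pow u k l = 0.
Proof.
move=> u0; elim: k l => [//|k IH] [|x l].
  by rewrite /conv_pow /= /conv big_seq1 u0 mul0r.
rewrite ltnS conv_pow_cons => hl; rewrite /conv big_seq big1 ?mulr0 // => p hp.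
have [/size_subseq hs _] := mem_splits_subseq hp.
by rewrite IH ?mul0r // (leq_ltn_trans hs).
Qed.

Definition conv_log g l : R :=
  \sum_(1 <= k < (size l).+1) (-1) ^+ k.-1 / k%:R * conv_pow (fun s => g s - conv1 s) k l.

(** The derivative of the logarithm is a geometric series times the derivative
    of g.  Its terms of index larger than [size l] vanish, so that one N serves
    for all sublists of a given list. *)
Lemma conv_log_cons g x N l : g [::] = 1 -> (size l <= N)%N ->
  conv_log g (x :: l) =
  \sum_(0 <= k < N.+1) (-1) ^+ k *
     conv (conv_pow (fun s => g s - conv1 s) k) (fun s => g (x :: s)) l.
Proof.
move=> g1 hN; rewrite /conv_log /= big_add1 /=.
rewrite (@big_cat_nat _ _ _ (size l).+1 0 N.+1) //= [X in _ + X]big_nat_cond.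
rewrite [X in _ + X]big1 ?addr0 => [|k /andP[/andP[hk _] _]]; last first.
  rewrite /conv big_seq big1 ?mulr0 // => p /mem_splits_subseq[/size_subseq hs _].
  by rewrite conv_pow_small ?mul0r ?g1 ?subrr // (leq_ltn_trans hs).
apply: eq_bigr => k _; rewrite conv_pow_cons mulrA mulfVK ?pnatr_eq0 //.
congr (_ * _); congr (conv _ _ _); apply/funext => s.
by rewrite /conv1 /= subr0.
Qed.

(** This is the identity d (log g) g = d g. *)
Lemma conv_log_rec g x l : g [::] = 1 ->
  g (x :: l) = \sum_(p <- splits l) conv_log g (x :: p.1) * g p.2.
Proof.
move=> g1; set u := fun s => g s - conv1 s; set gx := fun s => g (x :: s).
set N := size l; pose S (s : seq T) : R := \sum_(0 <= k < N.+1) (-1) ^+ k * conv (conv_pow u k) gx s.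
transitivity (conv S g l); last first.
  rewrite /conv big_seq [RHS]big_seq; apply: eq_bigr => p hp; congr (_ * _).
  have [/size_subseq hs _] := mem_splits_subseq hp.
  by rewrite (conv_log_cons _ g1 hs).
have gE : g = u \+ conv1 by apply/funext => s; rewrite /u /= subrK.
rewrite [X in conv S X]gE convDr (conv1r S) convC.
have -> : conv u S l =
    \sum_(0 <= k < N.+1) (-1) ^+ k * conv (conv_pow u k.+1) gx l.
  rewrite /conv /S; under eq_bigr do rewrite big_distrr /=.
  rewrite exchange_big /=; apply: eq_bigr => k _.
  rewrite -/(conv (conv_pow u k.+1) gx l) conv_powS convA.
  by rewrite -convZr.
rewrite /S -big_split /=.
pose F k := - ((-1) ^+ k * conv (conv_pow u k) gx l).
rewrite (eq_bigr (fun k => F k.+1 - F k)); last first.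
  by move=> k _; rewrite /F exprS mulN1r mulNr !opprK.
rewrite telescope_sumr // /F opprK expr0 mul1r (convC (conv_pow u 0)) conv1r.
rewrite /conv big_seq big1 ?mulr0 ?oppr0 ?add0r // => p.
move=> /mem_splits_subseq[/size_subseq hs _].
by rewrite conv_pow_small ?mul0r // /u /conv1 ?g1 ?subrr // ltnS.
Qed.

Lemma conv_log_cum (V : comPzRingType) (E : {additive V -> R}) (f : T -> V) g x l :
    E 1 = 1 -> (forall s, uniq s -> g s = mom E (map f s)) ->
  uniq (x :: l) -> conv_log g (x :: l) = cum E (f x) (map f l).
Proof.
move=> E1 Hg; elim: {l}(size l).+1 {-2}l (ltnSn (size l)) => // m IH l hl hu.
have := mom_cum E1 (f x) (map f l); rewrite -map_cons -Hg // conv_log_rec; last first.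
  by rewrite Hg // mom_nil.
rewrite splits_map big_map.
rewrite (big_splits_top (fun a b => conv_log g (x :: a) * g b)).
rewrite (big_splits_top (fun a b => cum E (f x) (map f a) * mom E (map f b))).
rewrite Hg //= mom_nil // !mulr1.
rewrite big_seq_cond [X in _ = _ + X]big_seq_cond.
rewrite (eq_bigr (fun p => cum E (f x) (map f p.1) * mom E (map f p.2))); last first.
  move=> p /andP[/mem_splits_subseq[h1 h2] hs]; rewrite Hg; last first.
    by apply: (subseq_uniq h2); case/andP: hu.
  rewrite IH //; first exact: leq_trans hs _.
  by apply: (subseq_uniq _ hu); rewrite /= eqxx.
by move/addIr.
Qed.

Lemma conv_pow_lin (y : T -> R) k l :
  conv_pow (fun s => if s is [:: x] then y x else 0) k l =
  if size l == k then k`!%:R * \prod_(x <- l) y x else 0.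
Proof.
set u := fun s => _.
elim: l k => [|x l IH] [|k].
- by rewrite big_nil mulr1.
- by rewrite conv_pow_small.
- by [].
rewrite conv_pow_cons convC /conv /= eqSS.
transitivity (k.+1%:R * (y x * conv_pow u k l)); last first.
  rewrite IH; case: eqP => _; last by rewrite !mulr0.
  by rewrite big_cons factS natrM; ring.
congr (_ * _); rewrite -[in RHS](conv1r (conv_pow u k)) -convZr convC.
rewrite /conv; apply: eq_bigr => -[[|a s] t] _ //=; rewrite /conv1 /=; ring.
Qed.
End Convolution.
#[global] Arguments conv_pow : simpl never.

Section FpsToLists.
Variables (R : realType) (r : nat).
Implicit Types (l : seq 'I_r) (f g : fps R r).

Definition sqfree (B : {set 'I_r}) : mindex r := [ffun i => nat_of_bool (i \in B)].

Lemma mdegree_sqfree B : mdegree (sqfree B) = #|B|.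
Proof.
rewrite /mdegree -sum1_card [RHS]big_mkcond; apply: eq_bigr => i _.
by rewrite ffunE; case: (i \in B).
Qed.

(** The divisors of a squarefree monomial are squarefree, and correspond to
    the subsets of its set of variables. *)
Lemma fps_mul_sqfree f g B :
  fps_mul f g (sqfree B) =
  \sum_(A : {set 'I_r} | A \subset B) f (sqfree A) * g (sqfree (B :\: A)).
Proof.
rewrite /fps_mul mdegree_sqfree.
pose h (A : {set 'I_r}) : {ffun 'I_r -> 'I_#|B|.+1} := [ffun i => inord (i \in A)].
pose h' (a : {ffun 'I_r -> 'I_#|B|.+1}) := [set i | a i != 0%N :> nat].
have hB i (A : {set 'I_r}) : A \subset B -> h A i = (i \in A) :> nat.
  move=> AB; rewrite ffunE inordK //; case: (boolP (i \in A)) => // iA.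
  by rewrite ltnS (cardD1 i) (fintype.subsetP AB).
rewrite (reindex_onto h h'); last first.
  move=> a /forallP ha; apply/ffunP => i; apply/val_inj.
  rewrite ffunE /h' inE; have := ha i.
  have [a0|a0] := eqVneq (a i : nat) 0%N => hi; first by rewrite /= a0 inordK.
  have a1 : a i = 1%N :> nat.
    by move: hi a0; rewrite ffunE; case: (i \in B); case: (nat_of_ord (a i)) => [|[]].
  by rewrite /= a1 inordK // -a1.
apply: eq_big => [A|A].
  apply/andP/idP => [[/forallP hA /eqP hA']|AB].
    apply/fintype.subsetP => i; rewrite -hA' inE => hi; have := hA i; rewrite [X in (_ <= X)%N]ffunE.
    by case: (i \in B) => //; rewrite leqn0 (negbTE hi).
  split; first by apply/forallP => i; rewrite hB // ffunE; have := fintype.subsetP AB i; case: (i \in A) => // ->.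
  by apply/eqP/finset.setP => i; rewrite inE hB //; case: (i \in A).
move=> /andP[/forallP hA /eqP hA'].
have AB : A \subset B.
  apply/fintype.subsetP => i; rewrite -hA' inE => hi; have := hA i; rewrite [X in (_ <= X)%N]ffunE.
  by case: (i \in B) => //; rewrite leqn0 (negbTE hi).
congr (f _ * g _); apply/ffunP => i; rewrite [LHS]ffunE [RHS]ffunE hB //.
by rewrite ffunE finset.in_setD; have := fintype.subsetP AB i; case: (i \in A) => [->|] //; case: (i \in B).
Qed.

Lemma sum_subset_splits (F : {set 'I_r} -> {set 'I_r} -> R) l : uniq l ->
  \sum_(A : {set 'I_r} | A \subset [set x in l]) F A ([set x in l] :\: A) =
  \sum_(p <- splits l) F [set x in p.1] [set x in p.2].
Proof.
elim: l F => [|x l IH] F /=.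
  move=> _; rewrite big_seq1 /= finset.set_nil (big_pred1 finset.set0) ?finset.setD0 // => A.
  by rewrite finset.subset0.
case/andP=> xl ul.
rewrite (big_splits_cons (fun a b => F [set x in a] [set x in b])) big_split /=.
have hx (a : seq 'I_r) : [set y in x :: a] = x |: [set y in a].
  by apply/finset.setP => y; rewrite !inE.
under [X in _ = X + _]eq_bigr do rewrite hx; under [X in _ = _ + X]eq_bigr do rewrite hx.
rewrite -(IH (fun A B => F (x |: A) B)) // -(IH (fun A B => F A (x |: B))) // hx.
rewrite (bigID (fun A : {set 'I_r} => x \in A)) /=; set L := [set y in l].
have xL : x \notin L by rewrite inE.
congr (_ + _).
  rewrite (reindex_onto (fun A => x |: A) (fun A => A :\ x)) /=; last first.
    by move=> A /andP[_ xA]; rewrite finset.setD1K.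
  apply: eq_big => [A|A].
    rewrite finset.setU11 andbT; apply/andP/idP => [[h1 /eqP h2]|h].
      by rewrite -h2 finset.subDset.
    have xA : x \notin A by apply: contra xL; exact: fintype.subsetP.
    by rewrite finset.setUS // finset.setU1K.
  move=> /andP[_ /eqP h2]; congr (F _ _).
  apply/finset.setP => y; rewrite !inE; case: (eqVneq y x) => //= ->.
  by move: xL; rewrite inE => /negbTE->; rewrite andbF.
apply: eq_big => [A|A /andP[_ xA]].
  rewrite andbC; apply/andP/idP => [[xA]|h].
    by move=> h; apply/fintype.subsetP => y yA; have := fintype.subsetP h y yA; rewrite finset.in_setU1 => /orP[/eqP e|//]; rewrite -e yA in xA.
  split; first by apply: contra xL; exact: fintype.subsetP.
  by apply: fintype.subset_trans h (finset.subsetUr _ _).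
congr (F _ _); apply/finset.setP => y; rewrite !inE; case: (eqVneq y x) => //= ->.
by rewrite xA.
Qed.

(** The restriction to squarefree monomials, indexed by the lists of distinct
    variables.  It is multiplicative ([fps_mul_list]) and retains all that the
    coefficient of t_1 ... t_r in a logarithm depends on. *)
Definition fps_list f l := f (sqfree [set x in l]).

Lemma fps_mul_list f g l : uniq l ->
  fps_list (fps_mul f g) l = conv (fps_list f) (fps_list g) l.
Proof.
move=> ul; rewrite /fps_list fps_mul_sqfree.
by rewrite (sum_subset_splits (fun A B => f (sqfree A) * g (sqfree B))).
Qed.

Lemma fps_pow_list f u k l : uniq l -> (forall s, uniq s -> fps_list f s = u s) ->
  fps_list (fps_pow f k) l = conv_pow u k l.
Proof.
move=> ul H; elim: k l ul => [|k IH] l ul.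
  rewrite /fps_list /fps_pow /= /fps_one mdegree_sqfree /conv_pow /= /conv1.
  by rewrite cardsE; move/card_uniqP: ul => ->; rewrite size_eq0.
rewrite /fps_pow /= -/(fps_pow f k) fps_mul_list // conv_powS /conv.
rewrite big_seq [RHS]big_seq; apply: eq_bigr => p /mem_splits_subseq[h1 h2].
by rewrite H ?IH ?(subseq_uniq _ ul).
Qed.

Lemma mdegree_list l : uniq l -> mdegree (sqfree [set x in l]) = size l.
Proof. by move=> ul; rewrite mdegree_sqfree cardsE; apply/card_uniqP. Qed.

Lemma fps_log_list f l : uniq l -> fps_list (fps_log f) l = conv_log (fps_list f) l.
Proof.
move=> ul; rewrite /fps_list /fps_log mdegree_list //; apply: eq_bigr => k _.
congr (_ * _); rewrite -/(fps_list _ l).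
apply: fps_pow_list => // s us; rewrite /fps_list /fps_one mdegree_list //.
by rewrite size_eq0.
Qed.

Lemma fps_exp_lin_list (x : 'I_r -> R) l : uniq l ->
  fps_list (fps_exp (fps_lin x)) l = \prod_(i <- l) x i.
Proof.
move=> ul; rewrite /fps_list /fps_exp mdegree_list //.
have Hlin s : uniq s -> fps_list (fps_lin x) s = if s is [:: i] then x i else 0.
  move=> us; rewrite /fps_list /fps_lin.
  have e i : (sqfree [set j in s] == [ffun j => nat_of_bool (j == i)]) = (s == [:: i]).
    apply/eqP/eqP => [/ffunP h|->].
      have hs j : (j \in s) = (j == i).
        by have := h j; rewrite !ffunE inE; case: (j \in s) (j == i) => -[].
      apply: perm_small_eq => //; apply: uniq_perm => // j.
      by rewrite hs inE.
    by apply/ffunP => j; rewrite !ffunE !inE.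
  under eq_bigr do rewrite e.
  case: s us {e} => [|i [|j s]] _; try by rewrite big1 // => k _; rewrite ?eqseq_cons ?andbF /= ?andbF mul0r.
  rewrite (bigD1 i) //= eqxx mul1r big1 ?addr0 // => j ji.
  by rewrite eqseq_cons eq_sym (negbTE ji) mul0r.
have Hk k : fps_pow (fps_lin x) k (sqfree [set i in l]) =
    if size l == k then k`!%:R * \prod_(i <- l) x i else 0.
  by rewrite -conv_pow_lin; exact: fps_pow_list.
rewrite (eq_bigr _ (fun k _ => f_equal2 _ (Hk k) erefl)); set y := \prod_(i <- l) x i.
rewrite big_mkord (bigD1 ord_max) //= eqxx mulrAC divff; last first.
  by rewrite pnatr_eq0 -lt0n fact_gt0.
rewrite mul1r big1 ?addr0 // => k hk; rewrite ifN ?mul0r //.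
by move: hk; rewrite -val_eqE /= eq_sym.
Qed.

End FpsToLists.

(** * Counting words by their new letters *)

Lemma perm_extend (T : finType) (u v : seq T) :
  uniq u -> uniq v -> size u = size v -> exists s : {perm T}, map s u = v.
Proof.
elim: u v => [|x u IH] [|y v] //=; first by exists 1%g.
move=> /andP[xu uu] /andP[yv uv] [huv]; have [s hs] := IH v uu uv huv.
exists (s * tperm (s x) y)%g; rewrite permM tpermL; congr cons.
rewrite -[in RHS]hs; apply/eq_in_map => z zu; rewrite permM tpermD //.
  by apply: contra xu => /eqP/perm_inj->.
by apply: contra yv => /eqP->; rewrite -hs map_f.
Qed.

Lemma non_uniq_map (T U : eqType) (f : T -> U) l : ~~ uniq (map f l) ->
  exists p q X, perm_eq l [:: p, q & X] /\ f p = f q.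
Proof.
elim: l => //= p l IH; rewrite negb_and negbK => /orP[/mapP[q ql fpq]|/IH].
  by exists p, q, (rem q l); split=> //; rewrite perm_cons perm_to_rem.
move=> [a [b [X [hl fab]]]]; exists a, b, (p :: X); split=> //.
rewrite -(perm_cons p) in hl; apply: (perm_trans hl).
by rewrite (perm_catCA [:: p] [:: a; b] X).
Qed.

Section Words.
Variables (n : nat).
Local Notation V := 'I_n.
Implicit Types (Z : {set V}) (t : seq V).

Fixpoint words k : seq (seq V) :=
  if k is k'.+1 then [seq x :: w | x <- enum V, w <- words k'] else [:: [::]].

Lemma big_words (R : nmodType) k (F : seq V -> R) :
  \sum_(t <- words k.+1) F t = \sum_(x : V) \sum_(t <- words k) F (x :: t).
Proof.
rewrite /= big_flatten big_map big_enum; apply: eq_bigr => x _.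
by rewrite big_map.
Qed.

Lemma size_words k t : t \in words k -> size t = k.
Proof.
elim: k t => [|k IH] t /=; first by rewrite inE => /eqP->.
by case/allpairsP => -[x w] /= [_ /IH<- ->].
Qed.

Definition generic Z t := uniq t && all [predC Z] t.

Lemma generic_cons Z x t : generic Z (x :: t) = (x \notin Z) && generic (x |: Z) t.
Proof.
rewrite /generic /=; case: (x \in Z) => /=; first by rewrite andbF.
rewrite -!andbA; case: (boolP (uniq t)) => /= ut; last by rewrite andbF.
have -> : all [predC x |: Z] t = (x \notin t) && all [predC Z] t.
  elim: t {ut} => //= y t ->; rewrite inE !inE negb_or (eq_sym x) negb_or.
  by rewrite -!andbA; do !bool_congr.
by [].
Qed.

Lemma generic_card Z t : (#|[set x in t] :\: Z| <= size t)%N /\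
  (generic Z t = (#|[set x in t] :\: Z| == size t)).
Proof.
have h1 : (#|[set x in t] :\: Z| <= #|[set x in t]|)%N by rewrite subset_leq_card ?subsetDl.
have h2 : (#|[set x in t]| <= size t)%N by rewrite cardsE card_size.
split; first exact: leq_trans h1 h2.
apply/andP/eqP => [[/card_uniqP ut /allP tZ]|h].
  have -> : [set x in t] :\: Z = [set x in t].
    apply/finset.setP => x; rewrite !inE.
    by case: (boolP (x \in t)) => [/tZ /= ->|]; rewrite ?andbF.
  by rewrite cardsE ut.
have e2 : #|[set x in t]| = size t by apply/eqP; rewrite eqn_leq h2 -h h1.
split; first by apply/card_uniqP; rewrite -e2 cardsE.
have /eqP eD : [set x in t] :\: Z == [set x in t].
  by rewrite eqEcard finset.subsetDl e2 h leqnn.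
apply/allP => x xt /=; have : x \in [set x in t] by rewrite inE.
by rewrite -eD inE => /andP[].
Qed.

Lemma count_generic k Z : ((n - #|Z| - k) ^ k <= count (generic Z) (words k))%N.
Proof.
elim: k Z => [|k IH] Z; first by rewrite expn0.
rewrite -sum1_count big_mkcond big_words.
rewrite (bigID (mem Z)) /= big1 ?add0n => [|x xZ]; last first.
  by rewrite big1_seq // => t _; rewrite generic_cons xZ.
apply: leq_trans (_ : \sum_(x : V | x \notin Z) (n - #|Z| - k.+1) ^ k <= _)%N; last first.
  apply: leq_sum => x xZ; rewrite -big_mkcond sum1_count.
  rewrite (eq_count (a2 := generic (x |: Z))) => [|t]; last by rewrite generic_cons xZ.
  by apply: leq_trans (IH _); rewrite cardsU1 xZ add1n !subnS -!subn1 -!subnDA; do 2![rewrite (addnC k)|].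
rewrite sum_nat_const expnS leq_mul2r; apply/orP; right.
have -> : #|[predC Z]| = (n - #|Z|)%N by have := cardC Z; rewrite card_ord; lia.
exact: leq_subr.
Qed.

(** The letters are summed one by one: a letter that is not in Z and has not
    occurred before contributes at most n terms of weight 1/n, and there are
    at most #|Z| + k other ones, of weight 1.  The bound is independent of n. *)
Lemma sum_words_new (R : numFieldType) k Z : (0 < n)%N ->
  \sum_(t <- words k) (n%:R^-1 : R) ^+ #|[set x in t] :\: Z| <= (#|Z| + k).+1%:R ^+ k.
Proof.
move=> n0; elim: k Z => [|k IH] Z.
  by rewrite /= big_seq1 finset.set_nil finset.set0D cards0 !expr0.
rewrite big_words (bigID (mem Z)) /=.
set B : R := (#|Z| + k.+1).+1%:R ^+ k.
have B0 : 0 <= B by rewrite exprn_ge0.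
apply: (@le_trans _ _ (#|Z|%:R * B + B)); last first.
  rewrite exprS -/B -[X in _ + X]mul1r -mulrDl ler_wpM2r // natr1 ler_nat ltnS leq_addr //.
have BZ x : \sum_(t <- words k) (n%:R^-1 : R) ^+ #|[set y in t] :\: (x |: Z)| <= B.
  apply: le_trans (IH _) _; rewrite lerXn2r ?nnegrE // ler_nat cardsU1.
  by case: (x \in Z) => /=; lia.
have h1 x t : x \notin Z ->
    #|[set y in x :: t] :\: Z| = #|[set y in t] :\: (x |: Z)|.+1.
  move=> xZ; rewrite [LHS](cardsD1 x) !inE eqxx xZ add1n; congr _.+1.
  have -> : ([set y in x :: t] :\: Z) :\ x = [set y in t] :\: (x |: Z).
    by apply/finset.setP => y; rewrite !inE; case: (y == x) => //=; rewrite andbF.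
  by [].
apply: lerD.
  rewrite -sum1_card natr_sum mulr_suml; apply: ler_sum => x xZ; rewrite mul1r.
  apply: le_trans (BZ x); apply: ler_sum => t _.
  have -> : [set y in x :: t] :\: Z = [set y in t] :\: (x |: Z); last by [].
  apply/finset.setP => y; rewrite !inE; case: eqP => //= ->.
  by rewrite (xZ : x \in Z).
apply: (@le_trans _ _ (\sum_(x : V) n%:R^-1 * B)); last first.
  rewrite sumr_const card_ord -[leLHS]mulr_natl mulrA divff ?mul1r //.
  by rewrite pnatr_eq0 -lt0n.
rewrite big_mkcond /=; apply: ler_sum => x _; case: ifP => [xZ|_]; last first.
  by rewrite mulr_ge0 ?invr_ge0.
rewrite (eq_bigr (fun t => n%:R^-1 * n%:R^-1 ^+ #|[set y in t] :\: (x |: Z)|)).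
  by rewrite -mulr_sumr ler_wpM2l ?invr_ge0.
by move=> t _; rewrite h1 // exprS.
Qed.
End Words.

(** * Points, chains and cycles of pairs *)

Section Vertices.
Variable n : nat.
Local Notation V := 'I_n.
Implicit Types (l Y X : seq (V * V)) (p q : V * V).

Definition verts l : {set V} := [set x in map fst l ++ map snd l].

Lemma in_verts x l : (x \in verts l) = (x \in map fst l) || (x \in map snd l).
Proof. by rewrite inE mem_cat. Qed.

Lemma verts_cons p l : verts (p :: l) = [set p.1; p.2] :|: verts l.
Proof.
apply/finset.setP => x; rewrite !in_verts /= !inE mem_cat -!orbA; do !bool_congr.
Qed.

Lemma verts_cat l1 l2 : verts (l1 ++ l2) = verts l1 :|: verts l2.
Proof.
apply/finset.setP => x; rewrite finset.in_setU !in_verts !map_cat !mem_cat -!orbA.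
by do !bool_congr; rewrite orbCA.
Qed.

Lemma verts_nil : verts [::] = finset.set0.
Proof. by apply/finset.setP => x; rewrite !inE. Qed.

Lemma verts_perm l1 l2 : perm_eq l1 l2 -> verts l1 = verts l2.
Proof.
move=> h; apply/finset.setP => x.
by rewrite !in_verts (perm_mem (perm_map fst h)) (perm_mem (perm_map snd h)).
Qed.

Lemma card_verts_le l : (#|verts l| <= 2 * size l)%N.
Proof.
rewrite cardsE (leq_trans (card_size _)) // size_cat !size_map; lia.
Qed.

Definition shares p l := (p.1 \in verts l) || (p.2 \in verts l).

(** Every pair shares a point with a later one, so that the list stays connected
    when its pairs are taken off from the left. *)
Fixpoint linked Y :=
  if Y is y :: Y' then nilp Y' || shares y Y' && linked Y' else true.

Lemma card_verts_shared (L L1 L2 : seq (V * V)) x :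
  verts L = verts L1 :|: verts L2 -> x \in verts L1 -> x \in verts L2 ->
  (#|verts L| + 1 <= #|verts L1| + #|verts L2|)%N.
Proof.
move=> -> x1 x2; have := cardsUI (verts L1) (verts L2).
have : (0 < #|verts L1 :&: verts L2|)%N by apply/card_gt0P; exists x; rewrite inE x1.
lia.
Qed.

Lemma sharesP p l : shares p l -> exists2 x, x \in [set p.1; p.2] & x \in verts l.
Proof.
by case/orP=> h; [exists p.1 | exists p.2] => //; rewrite !inE eqxx ?orbT.
Qed.

Definition relabel (s : {perm V}) p := (s p.1, s p.2).

Fixpoint ppath (x : V) (t : seq V) :=
  if t is a :: t' then (a, head x t') :: ppath x t' else [::].

Definition pcycle t := if t is a :: _ then ppath a t else [::].

Lemma size_ppath x t : size (ppath x t) = size t.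
Proof. by elim: t => //= a t ->. Qed.

Lemma size_pcycle t : size (pcycle t) = size t.
Proof. by case: t => // a t; rewrite size_ppath. Qed.

Lemma map_fst_ppath x t : map fst (ppath x t) = t.
Proof. by elim: t => //= a t ->. Qed.

Lemma map_snd_ppath x a t : map snd (ppath x (a :: t)) = rcons t x.
Proof. by elim: t a => //= b t IH a; rewrite -IH. Qed.

Lemma verts_pcycle t : verts (pcycle t) = [set x in t].
Proof.
case: t => [|a t]; first by rewrite verts_nil finset.set_nil.
apply/finset.setP => x; rewrite in_verts map_fst_ppath map_snd_ppath [RHS]inE.
by rewrite mem_rcons inE orbb.
Qed.

Lemma linked_ppath x t : linked (ppath x t).
Proof.
elim: t => //= a [|b t] //= IH; rewrite IH andbT.
by rewrite /shares verts_cons /= !inE eqxx !orbT.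
Qed.

Lemma linked_pcycle t : linked (pcycle t).
Proof. by case: t => // a t; apply: linked_ppath. Qed.

Lemma relabel_ppath s x t : map (relabel s) (ppath x t) = ppath (s x) (map s t).
Proof. by elim: t => //= a t ->; case: t. Qed.

Lemma relabel_pcycle s t : map (relabel s) (pcycle t) = pcycle (map s t).
Proof. by case: t => // a t; exact: (relabel_ppath s a (a :: t)). Qed.

Lemma relabel_fix (s : {perm V}) l : {in verts l, s =1 id} -> map (relabel s) l = l.
Proof.
move=> h; rewrite -[RHS]map_id; apply/eq_in_map => -[i j] pl.
by rewrite /relabel /= !h ?in_verts //; apply/orP; [right|left];
  [apply: (map_f snd pl) | apply: (map_f fst pl)].
Qed.

Lemma ppath_traject (f : V -> V) x a k : iter k f a = x ->
  ppath x (traject f a k) = [seq (y, f y) | y <- traject f a k].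
Proof.
elim: k a => // k IH a h.
have {}IH := IH (f a) (etrans (esym (iterSr _ _ _)) h).
by rewrite /= IH; congr ((_, _) :: _); case: k h {IH} => [<-|].
Qed.

(** Under these hypotheses the pairs are the graph of a permutation, restricted
    to a stable set of points.  An orbit in this set is a cycle, and no other
    pair touches it. *)
Lemma cycle_extraction l : l != [::] ->
    uniq (map fst l) -> uniq (map snd l) -> {subset map snd l <= map fst l} ->
  exists t X, [/\ t != [::], perm_eq l (pcycle t ++ X) & generic (verts X) t].
Proof.
move=> l0 u1 u2 sub.
have [s hs] := perm_extend u1 u2 (etrans (size_map _ _) (esym (size_map _ _))).
set L := map fst l in u1 sub hs *.
have lE : l = [seq (y, s y) | y <- L].
  rewrite -map_comp -[LHS]map_id; apply/eq_in_map => -[i j] pl /=.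
  congr (_, _).
  have := hs; rewrite /L -map_comp => /eq_in_map /(_ _ pl) /= ->//.
have sL y : y \in L -> s y \in L by move=> yL; apply: sub; rewrite -hs map_f.
have [x xL] : exists x, x \in L.
  by rewrite /L; case: l l0 {u1 u2 sub hs lE sL L} => //= p l; exists p.1; rewrite mem_head.
pose t := traject s x #|porbit s x|.
have t0 : t != [::] by rewrite -size_eq0 size_traject card_porbit_neq0.
have tL : {subset t <= L}.
  move=> y /trajectP[i _ ->]; elim: i => //= i IH; exact: sL.
have tE : pcycle t = [seq (y, s y) | y <- t].
  rewrite -(ppath_traject (iter_porbit s x)) /t.
  by have := card_porbit_neq0 s x; case: #|_|.
have tP y : (y \in t) = (y \in porbit s x) by rewrite porbit_traject.
pose L' := [seq y <- L | y \notin t].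
have pL : perm_eq L (t ++ L').
  apply: (perm_trans (y := [seq y <- L | y \in t] ++ L')).
    by rewrite perm_sym; apply/permPl/(perm_filterC (mem t)).
  rewrite perm_cat2r.
  apply: uniq_perm; rewrite ?filter_uniq ?uniq_traject_porbit // => y.
  rewrite mem_filter /=; case: (boolP (y \in t)) => //= /tL -> //.
exists t, [seq (y, s y) | y <- L']; split=> //.
  by rewrite tE -map_cat lE perm_map.
rewrite /generic uniq_traject_porbit /=; apply/allP => y yt /=.
rewrite in_verts -!map_comp negb_or; apply/andP; split.
  by apply/negP => /mapP[z]; rewrite mem_filter /= => /andP[zt _] yz; rewrite -yz yt in zt.
apply/negP => /mapP[z]; rewrite mem_filter /= => /andP[zt _] yz.
move: zt yt; rewrite yz !tP -!eq_porbit_mem.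
by rewrite (porbit_perm s 1 z) => /negbTE->.
Qed.

End Vertices.

(** * Averages over a conjugacy class of permutations *)

Section ClassAverage.
Variables (R : realFieldType) (n : nat) (A : {set {perm 'I_n}}).
Local Notation V := ({perm 'I_n} -> R).
Implicit Types (l Y X : seq ('I_n * 'I_n)) (p q : 'I_n * 'I_n).

Definition avg (f : V) : R := (\sum_(s in A) f s) / #|A|%:R.

Fact avg_is_zmod_morphism : zmod_morphism avg.
Proof. by move=> f g; rewrite /avg -mulrBl -sumrB. Qed.
HB.instance Definition _ := GRing.isZmodMorphism.Build V R avg avg_is_zmod_morphism.

Definition mx_entry p : V := fun s => (s p.1 == p.2)%:R.

Definition entry_cum l : R := if l is p :: l' then cum avg (mx_entry p) (map mx_entry l') else 0.

Hypothesis A0 : A != finset.set0.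
Hypothesis AJ : forall s t, s \in A -> (s ^ t)%g \in A.

Lemma cardA_neq0 : #|A|%:R != 0 :> R.
Proof. by rewrite pnatr_eq0 cards_eq0. Qed.

Lemma avg_const (f : V) c : {in A, forall s, f s = c} -> avg f = c.
Proof.
move=> h; rewrite /avg (eq_bigr _ h) sumr_const -[c *+ _]mulr_natr mulfK //.
exact: cardA_neq0.
Qed.

Lemma avg1 : avg 1 = 1. Proof. exact: avg_const. Qed.

Lemma avg_scale (f g : V) c : {in A, forall s, f s = c} -> avg (f * g) = c * avg g.
Proof.
move=> h; rewrite /avg mulrA mulr_sumr; congr (_ / _); apply: eq_bigr => s /h /= <-.
by [].
Qed.

Lemma entry_prod l s : (\prod_(v <- map mx_entry l) v) s = \prod_(p <- l) mx_entry p s.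
Proof.
elim: l => [|p l IH]; first by rewrite !big_nil.
by rewrite /= !big_cons -IH.
Qed.

Lemma entry_prod01 l s : 0 <= (\prod_(v <- map mx_entry l) v) s <= 1.
Proof.
rewrite entry_prod; elim: l => [|p l IH]; first by rewrite big_nil ler01 lexx.
rewrite big_cons /mx_entry; case: eqP => _; rewrite ?mul1r ?mul0r //.
by rewrite lexx ler01.
Qed.

Lemma mom_entry_le1 l : `|mom avg (map mx_entry l)| <= 1.
Proof.
rewrite /mom /= /avg ger0_norm; last first.
  apply: divr_ge0 => //; apply: sumr_ge0 => s _.
  by case/andP: (entry_prod01 l s).
rewrite ler_pdivrMr; last by rewrite ltr0n card_gt0.
rewrite mul1r -sum1_card natr_sum; apply: ler_sum => s _.
by case/andP: (entry_prod01 l s).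
Qed.

Lemma entry_cum_trivial l : `|entry_cum l| <= (cum_ub (size l))%:R.
Proof.
case: l => [|p l] /=; first by rewrite normr0.
apply: le_trans (cum_bounded _ _ mom_entry_le1) _.
by rewrite ler_nat (cum_ub_mono (leqnSn _)).
Qed.

Lemma entry_cum_perm l l' : perm_eq l l' -> entry_cum l = entry_cum l'.
Proof.
case: l => [|p l]; case: l' => [|q l'] //.
- by move=> h; move: (perm_size h).
- by move=> h; move: (perm_size h).
case: (eqVneq p q) => [->|pq] h.
  rewrite perm_cons in h; rewrite /=; apply: cum_perm_tail; exact: perm_map.
have ql : q \in l.
  have : q \in p :: l by rewrite (perm_mem h) mem_head.
  by rewrite inE eq_sym (negbTE pq).
rewrite /= (cum_perm_tail _ _ (perm_map mx_entry (perm_to_rem ql))) /=.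
rewrite (cum_swap (E := avg) avg1); apply: cum_perm_tail; rewrite -map_cons.
apply: perm_map; rewrite -(perm_cons q) -(permPr h).
rewrite (perm_catCA [:: q] [:: p] (rem q l)) /= perm_cons perm_sym.
exact: perm_to_rem.
Qed.

(** The action of conjugation on functions, by ring automorphisms which preserve
    the average over A; it moves the entry at (i, j) to the one at (s i, s j). *)
Definition twist (s : {perm 'I_n}) (f : V) : V := fun u => f (u ^ s^-1)%g.

Lemma mom_twist s (l : seq V) : mom avg (map (twist s) l) = mom avg l.
Proof.
have e (u : seq V) : \prod_(f <- map (twist s) u) f = twist s (\prod_(f <- u) f).
  elim: u => [|f u IH] /=; first by rewrite !big_nil.
  by rewrite !big_cons IH.
rewrite /mom e /avg; congr (_ / _).
rewrite (reindex_inj (h := fun u => (u ^ s)%g)) /=; last exact: conjg_inj.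
apply: eq_big => u.
  apply/idP/idP => [h|h]; last exact: AJ.
  by have := AJ s^-1%g h; rewrite conjgK.
by move=> _; rewrite /twist conjgK.
Qed.

Lemma cum_twist s x (l : seq V) : cum avg (twist s x) (map (twist s) l) = cum avg x l.
Proof.
have := @eq_cum R V V avg avg V (twist s) id x l; rewrite map_id; apply => u.
by rewrite map_id mom_twist.
Qed.

Lemma twist_entry s p : twist s (mx_entry p) = mx_entry (relabel s p).
Proof.
apply/funext => u; rewrite /twist /mx_entry /= -[in RHS](conjgKV s u) permJ.
by rewrite (inj_eq perm_inj).
Qed.

End ClassAverage.

(** * The estimate for cumulants of permutation matrix entries *)

(** The constants in [cum_prod_linked], by recursion on the number of factors:
    C0 bounds the cumulants of smaller order. *)
Fixpoint chain_err (R : pzRingType) (C0 : R) (r m : nat) : R :=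
  if m is m'.+1 then
    chain_err C0 r m' + (2 ^ r)%:R * (C0 * (C0 + chain_err C0 r m')) else 0.

Section InductionStep.
Variables (R : realFieldType) (n : nat) (A : {set {perm 'I_n}}).
Local Notation V := ({perm 'I_n} -> R).
Implicit Types (l Y X I J : seq ('I_n * 'I_n)) (p q : 'I_n * 'I_n).
Local Notation entry := (@mx_entry R n).
Local Notation entry_cum := (@entry_cum R n A).
Local Notation avg := (@avg R n A).

Definition entry_cum_le (C : R) l := `|entry_cum l| * n%:R ^+ #|verts l| <= C * n%:R.

Hypothesis n0 : (0 < n)%N.
Hypothesis A0 : A != finset.set0.
Hypothesis AJ : forall s t, s \in A -> (s ^ t)%g \in A.

Let n1 : 1 <= n%:R :> R. Proof. by rewrite ler1n. Qed.
Let np : 0 < n%:R :> R. Proof. by rewrite ltr0n. Qed.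

Lemma mul_bound (x y C D : R) (a b c : nat) : 0 <= x -> 0 <= y ->
  x * n%:R ^+ a <= C * n%:R -> y * n%:R ^+ b <= D * n%:R -> (c + 1 <= a + b)%N ->
  x * y * n%:R ^+ c <= C * D * n%:R.
Proof.
move=> x0 y0 hx hy hc; rewrite -(ler_pM2r np).
apply: (@le_trans _ _ ((x * n%:R ^+ a) * (y * n%:R ^+ b))).
  rewrite [leRHS]mulrACA -exprD -[leLHS]mulrA -exprSr ler_wpM2l ?mulr_ge0 //.
  by apply: ler_weXn2l => //; rewrite -addn1.
apply: le_trans (ler_pM _ _ hx hy) _; rewrite ?mulr_ge0 ?exprn_ge0 ?ler0n //.
by rewrite mulrACA mulrA.
Qed.

(** This bounds the second term of [cumM].  The point shared by the two factors
    reduces by one the number of points of the union, and this accounts for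
    the factor n that is lost in a product of two bounds. *)
Lemma cross_sum Y1 Y2 X (f g : seq ('I_n * 'I_n) -> R) (C D : R) x :
    x \in verts Y1 -> x \in verts Y2 ->
    (forall I, (size I <= size X)%N -> `|f I| * n%:R ^+ #|verts (Y1 ++ I)| <= C * n%:R) ->
    (forall I, (size I <= size X)%N -> `|g I| * n%:R ^+ #|verts (Y2 ++ I)| <= D * n%:R) ->
  `|\sum_(P <- splits X) f P.1 * g P.2| * n%:R ^+ #|verts (Y1 ++ Y2 ++ X)|
    <= (2 ^ size X)%:R * (C * D) * n%:R.
Proof.
move=> x1 x2 hf hg.
apply: (@le_trans _ _ (\sum_(P <- splits X) C * D * n%:R)); last first.
  rewrite big_const_seq count_predT iter_addr addr0 size_splits -[leLHS]mulr_natl.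
  by rewrite mulrA.
apply: le_trans (ler_wpM2r _ (ler_norm_sum _ _ _)) _; first by rewrite exprn_ge0.
rewrite mulr_suml big_seq [leRHS]big_seq; apply: ler_sum => P hP.
have [/size_subseq s1 /size_subseq s2] := mem_splits_subseq hP.
rewrite normrM; apply: (mul_bound _ _ (hf _ s1) (hg _ s2)) => //.
apply: (card_verts_shared (x := x)); rewrite ?verts_cat ?finset.in_setU ?x1 ?x2 //.
rewrite -(verts_perm (mem_splits_perm hP)) verts_cat.
by rewrite finset.setUA finset.setUACA.
Qed.

Variables (C0 : R) (r s : nat).
Hypothesis C01 : 1 <= C0.
Hypothesis IHr : forall l, (size l < r)%N -> entry_cum_le C0 l.
Hypothesis IHs : forall l, size l = r -> (#|verts l| < s)%N -> entry_cum_le C0 l.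

Local Notation err := (chain_err C0 r).
Let C00 : 0 <= C0. Proof. by apply: le_trans C01. Qed.

Lemma chain_err_ge0 m : 0 <= err m.
Proof. by elim: m => //= m IH; rewrite addr_ge0 ?mulr_ge0 ?addr_ge0. Qed.

Lemma chain_err_mono : {homo err : m k / (m <= k)%N >-> m <= k}.
Proof.
apply: homo_leq => [x|y x z|m]; [exact: lexx|exact: le_trans|].
by rewrite /= lerDl ?mulr_ge0 ?addr_ge0 ?chain_err_ge0.
Qed.

Definition prod_entry Y : V := \prod_(y <- Y) entry y.

(** The factors are split off one at a time by means of [cumM].  The error
    consists of products of cumulants of smaller order, in which the factors
    share a point because Y is linked. *)
Lemma cum_prod_linked Y X : Y != [::] -> linked Y -> (size Y + size X <= r)%N ->
  `|cum avg (prod_entry Y) (map entry X) - entry_cum (Y ++ X)| * n%:R ^+ #|verts (Y ++ X)|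
    <= err (size Y) * n%:R.
Proof.
elim: Y X => // y Y IH X _; case: (posnP (size Y)) => [/eqP/nilP-> _ _|Y0].
  rewrite /prod_entry big_seq1 /= subrr normr0 mul0r mulr_ge0 //.
  exact: (chain_err_ge0 1).
have {}Y0 : Y != [::] by rewrite -size_eq0 -lt0n.
have -> : linked (y :: Y) = shares y Y && linked Y by rewrite /= /nilp size_eq0 (negbTE Y0).
move=> /andP[shy lY] hsz; have {}hsz : ((size Y).+1 + size X <= r)%N := hsz.
rewrite /prod_entry big_cons -/(prod_entry Y) (cumM (avg1 R A0)).
have -> : cum avg (entry y) (prod_entry Y :: map entry X) =
          cum avg (prod_entry Y) (map entry (y :: X)).
  by rewrite (cum_swap (avg1 R A0)).
have pYX : perm_eq (Y ++ y :: X) (y :: Y ++ X).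
  by rewrite -cat1s (perm_catCA Y [:: y] X).
have -> : entry_cum ((y :: Y) ++ X) = entry_cum (Y ++ y :: X) by rewrite (entry_cum_perm R A0 pYX).
rewrite splits_map big_map /=.
rewrite addrAC; apply: le_trans (ler_wpM2r _ (ler_normD _ _)) _.
  by rewrite exprn_ge0.
rewrite mulrDl mulrDl lerD //.
  rewrite -(verts_perm pYX); apply: (IH (y :: X)) => //=; move: hsz => /=; clear; lia.
have [x xy xY] := sharesP shy.
have := @cross_sum [:: y] Y X (fun I => cum avg (entry y) (map entry I))
  (fun J => cum avg (prod_entry Y) (map entry J)) C0 (C0 + err (size Y)) x.
rewrite verts_cons verts_nil finset.setU0 => /(_ xy xY) H.
apply: le_trans (H _ _) _.
- move=> I hI; apply: (IHr (l := y :: I)) => /=.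
  have : (0 < size Y)%N by rewrite lt0n size_eq0.
  by move: hI hsz; clear; lia.
- move=> J hJ; rewrite -[X in `|X|](subrK (entry_cum (Y ++ J))).
  apply: le_trans (ler_wpM2r _ (ler_normD _ _)) _; first by rewrite exprn_ge0.
  rewrite mulrDl mulrDl addrC lerD //.
    by apply: IHr; rewrite size_cat; move: hJ hsz; clear; lia.
  by apply: IH => //; move: hJ hsz; clear; lia.
- rewrite ler_pM2r // ler_wpM2r ?mulr_ge0 ?addr_ge0 ?chain_err_ge0 //.
  by rewrite ler_nat leq_exp2l //; move: hsz; clear; lia.
Qed.

(** A row or a column of a permutation matrix contains a single 1: the product
    of the entries at p and q is 0 if p and q differ, and the entry at p
    otherwise. *)
Lemma entry_cum_shared p q X : size [:: p, q & X] = r ->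
  (p.1 == q.1) || (p.2 == q.2) ->
  entry_cum_le (C0 + (2 ^ r)%:R * (C0 * C0)) [:: p, q & X].
Proof.
move=> hsz pq; rewrite /entry_cum_le /=.
have := cumM (avg1 R A0) (entry p) (entry q) (map entry X) => /eqP.
rewrite -subr_eq => /eqP <-.
apply: le_trans (ler_wpM2r _ (ler_normB _ _)) _; first by rewrite exprn_ge0.
rewrite mulrDl mulrDl lerD //.
  have -> : entry p * entry q = if p == q then entry p else 0.
    apply/funext => u; rewrite /mx_entry /=.
    transitivity ((u p.1 == p.2)%:R * (u q.1 == q.2)%:R : R); first by [].
    case: (eqVneq p q) => [->|npq].
      by case: eqP => _; rewrite ?mulr1 ?mulr0.
    case: eqP => h1; rewrite ?mul0r //; case: eqP => h2; rewrite ?mulr0 //.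
    case/negP: npq; rewrite -pair_eqE /= /pair_eq -h1 -h2.
    case/orP: pq => /eqP e; first by rewrite e !eqxx.
    have /perm_inj e' : u p.1 = u q.1 by rewrite h1 h2.
    by rewrite e' !eqxx.
  case: (eqVneq p q) => [epq|npq]; last by rewrite (cum0 (avg1 R A0)) normr0 mul0r mulr_ge0.
  have := IHr (l := p :: X); rewrite /entry_cum_le -hsz /= ltnS => /(_ (leqnn _)).
  by rewrite -epq !verts_cons finset.setUA finset.setUid.
rewrite splits_map big_map.
have [x xp xq] : exists2 x, x \in verts [:: p] & x \in verts [:: q].
  case/orP: pq => /eqP e; [exists p.1 | exists p.2];
  by rewrite !verts_cons !inE ?e eqxx ?orbT.
have := @cross_sum [:: p] [:: q] X (fun I => cum avg (entry p) (map entry I))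
  (fun J => cum avg (entry q) (map entry J)) C0 C0 x xp xq.
move=> H; apply: le_trans (H _ _) _.
- by move=> I hI; apply: (IHr (l := p :: I)); rewrite -hsz /=; move: hI; clear; lia.
- by move=> I hI; apply: (IHr (l := q :: I)); rewrite -hsz /=; move: hI; clear; lia.
by rewrite ler_pM2r // ler_wpM2r ?mulr_ge0 // ler_nat leq_exp2l // -hsz /=; clear; lia.
Qed.


Lemma cum_relabel (t : {perm 'I_n}) Y X :
  cum avg (prod_entry (map (relabel t) Y)) (map entry (map (relabel t) X)) =
  cum avg (prod_entry Y) (map entry X).
Proof.
rewrite -(cum_twist AJ t (prod_entry Y) (map entry X)) -!map_comp.
have -> : prod_entry (map (relabel t) Y) = twist t (prod_entry Y).
  rewrite /prod_entry; elim: Y => [|y Y IH]; first by rewrite !big_nil.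
  by rewrite /= !big_cons IH -twist_entry.
by congr (cum _ _ _); apply: eq_map => p /=; rewrite twist_entry.
Qed.

(** All generic words of the same length are equivalent under the permutations
    that fix Z, hence give the same cumulant. *)
Lemma generic_transitive (Z : {set 'I_n}) t t' : size t = size t' ->
  generic Z t -> generic Z t' ->
  exists2 g : {perm 'I_n}, map g t = t' & {in Z, g =1 id}.
Proof.
move=> hs /andP[ut tZ] /andP[ut' tZ'].
have hu w : uniq w -> all [predC Z] w -> uniq (enum Z ++ w).
  move=> uw wZ; rewrite cat_uniq enum_uniq uw andbT /=.
  by apply/hasPn => x /(allP wZ) /=; rewrite mem_enum.
have hsz : size (enum Z ++ t) = size (enum Z ++ t') by rewrite !size_cat hs.
have [g hg] := perm_extend (hu _ ut tZ) (hu _ ut' tZ') hsz.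
move: hg; rewrite map_cat => /eqP; rewrite eqseq_cat ?size_map // => /andP[/eqP h1 /eqP h2].
exists g => // x xZ.
have /eq_in_map/(_ x) -> // : map g (enum Z) = map id (enum Z) by rewrite h1 map_id.
by rewrite mem_enum.
Qed.

Definition sum_const (k : nat) : R :=
  (2 ^ k)%:R * (1 + (C0 + err r) * (s.+1 ^ k)%:R) + err r.

(** The word t stands for the k points of the list [Yf t] that are summed over,
    while S0 contains its other points.  The products of the entries in [Yf t]
    add up to a constant, so their cumulants with X add up to 0, or to c if X
    is empty.  The generic words all contribute the same value, and there are
    at least (n / 2) ^ k of them; for the other words there are fewer points,
    and the hypothesis on smaller numbers of points applies, the resulting
    bounds being summed by [sum_words_new]. *)
Lemma entry_cum_by_summation k (Yf : seq 'I_n -> seq ('I_n * 'I_n)) (S0 : {set 'I_n}) X c t0 :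
    (forall t, size t = k -> [/\ Yf t != [::], linked (Yf t),
       size (Yf t) + size X = r & verts (Yf t) = S0 :|: [set x in t]])%N ->
    (forall (g : {perm 'I_n}) t, size t = k -> {in S0, g =1 id} ->
       map (relabel g) (Yf t) = Yf (map g t)) ->
    {in A, forall u, \sum_(t <- words n k) \prod_(y <- Yf t) entry y u = c} ->
    0 <= c -> c * n%:R ^+ #|S0| <= n%:R ->
    size t0 = k -> generic (S0 :|: verts X) t0 ->
    (#|S0 :|: verts X| + k = s)%N -> (2 * s <= n)%N ->
  entry_cum_le (sum_const k) (Yf t0 ++ X).
Proof.
move=> HY Hrel Hc c0 cS ht0 gt0 hs sn.
set Z := S0 :|: verts X in gt0 hs.
pose Q t := cum avg (prod_entry (Yf t)) (map entry X).
pose C2 := C0 + err r.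
have C20 : 0 <= C2 by rewrite addr_ge0 ?chain_err_ge0.
have vE t : size t = k -> #|verts (Yf t ++ X)| = (#|Z| + #|[set x in t] :\: Z|)%N.
  move=> /HY[_ _ _ h]; rewrite verts_cat h finset.setUAC -/Z.
  have := cardsUI Z [set x in t]; have := cardsID Z [set x in t].
  rewrite (finset.setIC [set x in t] Z); by move=> <-; rewrite addnCA addnC => /addnI.
have Qclose t : size t = k ->
    `|Q t - entry_cum (Yf t ++ X)| * n%:R ^+ (#|Z| + #|[set x in t] :\: Z|) <= err r * n%:R.
  move=> hk; have [h1 h2 h3 h4] := HY t hk.
  rewrite -vE //; apply: le_trans (cum_prod_linked h1 h2 _) _; first by rewrite h3.
  by rewrite ler_pM2r //; apply: chain_err_mono; rewrite -h3 leq_addr.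
(* A word that is not generic brings fewer than k new points. *)
have Qnew t : size t = k -> ~~ generic Z t ->
    `|Q t| * n%:R ^+ #|Z| <= C2 * n%:R * n%:R^-1 ^+ #|[set x in t] :\: Z|.
  move=> hk hg; rewrite exprVn ler_pdivlMr ?exprn_gt0 // -mulrA -exprD.
  rewrite -[X in `|X|](subrK (entry_cum (Yf t ++ X))).
  apply: le_trans (ler_wpM2r _ (ler_normD _ _)) _; first by rewrite exprn_ge0.
  rewrite mulrDl /C2 mulrDl addrC lerD //; last exact: Qclose.
  rewrite -vE //; apply: IHs; first by rewrite size_cat; case: (HY t hk).
  have [g1 g2] := generic_card Z t.
  by rewrite vE // -hs ltn_add2l -hk ltn_neqAle -g2 hg g1.
have Hsum : \sum_(t <- words n k) Q t = if X is [::] then c else 0.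
  rewrite -(cum_sum (avg1 R A0)) (cum_const (avg1 R A0) (c := c)); first by case: (X).
  move=> f; apply: avg_scale => u uA; rewrite fct_sumE -(Hc u uA).
  by apply: eq_bigr => t _; rewrite /prod_entry fct_prodE.
have HsumZ : `|\sum_(t <- words n k) Q t| * n%:R ^+ #|Z| <= n%:R.
  rewrite Hsum /Z; case: (X) => [|p X']; last by rewrite normr0 mul0r ler0n.
  by rewrite verts_nil finset.setU0 ger0_norm.
pose cnt := count (generic Z) (words n k).
have Hgen : `|Q t0| * cnt%:R * n%:R ^+ #|Z| <= n%:R * (1 + C2 * (s.+1 ^ k)%:R).
  have -> : `|Q t0| * cnt%:R = `|\sum_(t <- words n k | generic Z t) Q t|.
    rewrite big_seq_cond (eq_bigr (fun=> Q t0)); last first.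
      move=> t /andP[/size_words tk gt].
      have [g gt' gZ] := generic_transitive (etrans ht0 (esym tk)) gt0 gt.
      rewrite /Q -gt' -Hrel //; last by move=> x xS; apply: gZ; rewrite inE xS.
      rewrite -{1}(@relabel_fix _ g X) ?cum_relabel // => x xX.
      by apply: gZ; rewrite finset.in_setU xX orbT.
    rewrite -big_seq_cond big_const_seq iter_addr addr0 -/cnt.
    by rewrite normrMn mulr_natr.
  have -> : \sum_(t <- words n k | generic Z t) Q t =
     \sum_(t <- words n k) Q t - \sum_(t <- words n k | ~~ generic Z t) Q t.
    by rewrite [in RHS](bigID (generic Z)) /= addrK.
  apply: le_trans (ler_wpM2r _ (ler_normB _ _)) _; first by rewrite exprn_ge0.
  rewrite mulrDl mulrDr mulr1 lerD //.
  apply: le_trans (ler_wpM2r _ (ler_norm_sum _ _ _)) _; first by rewrite exprn_ge0.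
  rewrite mulr_suml; apply: (@le_trans _ _ (\sum_(t <- words n k)
      C2 * n%:R * n%:R^-1 ^+ #|[set x in t] :\: Z|)).
    rewrite big_mkcond /= big_seq [leRHS]big_seq; apply: ler_sum => t /size_words tk.
    case: ifP => [/Qnew|_]; first exact.
    by rewrite !mulr_ge0 ?exprn_ge0 ?invr_ge0.
  rewrite -mulr_sumr mulrA (mulrC n%:R) ler_wpM2l ?mulr_ge0 //.
  apply: le_trans (sum_words_new R k Z n0) _.
  by rewrite hs natrX.
(* At least (n - s) ^ k words are generic, and n <= 2 (n - s). *)
have Hcnt : n%:R ^+ k <= (2 ^ k)%:R * cnt%:R :> R.
  rewrite -natrX -natrM ler_nat; apply: leq_trans (leq_mul (leqnn _) (count_generic k Z)).
  rewrite -expnMn; case: (posnP k) => [->|k0]; first by rewrite !expn0.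
  by rewrite leq_exp2r //; move: hs sn; clear; lia.
rewrite /entry_cum_le vE //; have [_ gE] := generic_card Z t0.
have /eqP gE0 : #|[set x in t0] :\: Z| == k by rewrite -[X in _ == X]ht0 -gE.
rewrite -[X in `|X|](subrK (Q t0)).
apply: le_trans (ler_wpM2r _ (ler_normD _ _)) _; first by rewrite exprn_ge0.
rewrite mulrDl /sum_const mulrDl addrC lerD //; last by rewrite distrC Qclose.
rewrite gE0 exprD mulrA.
apply: (@le_trans _ _ (`|Q t0| * n%:R ^+ #|Z| * ((2 ^ k)%:R * cnt%:R))).
  by rewrite ler_wpM2l // mulr_ge0 ?exprn_ge0.
rewrite mulrCA -[leRHS]mulrA ler_wpM2l // mulrAC [leRHS]mulrC.
exact: Hgen.
Qed.


Lemma sum_const_ge0 k : 0 <= sum_const k.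
Proof.
by rewrite /sum_const addr_ge0 ?mulr_ge0 ?addr_ge0 ?mulr_ge0 ?addr_ge0 ?chain_err_ge0.
Qed.

(** The sum runs over the second coordinate of p: it is a row sum of the
    permutation matrix. *)
Lemma entry_cum_leaf p X : size (p :: X) = r -> #|verts (p :: X)| = s -> (2 * s <= n)%N ->
  p.1 != p.2 -> p.2 \notin verts X -> entry_cum_le (sum_const 1) (p :: X).
Proof.
move=> hr hs sn p12 p2X.
have pE : [:: (p.1, head p.1 [:: p.2])] ++ X = p :: X by rewrite /=; case: (p).
have gen : generic ([set p.1] :|: verts X) [:: p.2].
  by rewrite /generic /= finset.in_setU inE negb_or eq_sym p12 p2X.
rewrite -pE.
apply: (@entry_cum_by_summation 1 (fun t => [:: (p.1, head p.1 t)]) [set p.1] X 1) => //.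
- case=> [|x [|//]] // _; split=> //=.
  rewrite verts_cons verts_nil finset.setU0 /=.
  by apply/finset.setP => z; rewrite !inE.
- by move=> g [|x [|//]] // _ hg; rewrite /= /relabel /= hg ?inE.
- move=> u _; rewrite big_words.
  under eq_bigr do rewrite big_seq1 big_seq1.
  rewrite (bigD1 (u p.1)) //= /mx_entry /= eqxx big1 ?addr0 // => x.
  by rewrite eq_sym => /negbTE->.
- by rewrite cards1 expr1 mul1r.
- rewrite -hs verts_cons finset.setUAC [in RHS]finset.setUC [RHS]cardsU1 finset.in_setU finset.in_set1.
  by rewrite (eq_sym p.2) (negbTE p12) (negbTE p2X) addnC.
Qed.

Lemma sum_ppath k x a (u : {perm 'I_n}) :
  \sum_(t <- words n k) \prod_(y <- ppath x (a :: t)) entry y u =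
  (iter k.+1 u a == x)%:R.
Proof.
elim: k a => [|k IH] a; first by rewrite /= !big_seq1.
rewrite big_words iterSr -IH (bigD1 (u a)) //= [X in _ + X]big1 ?addr0.
  by apply: eq_bigr => t _; rewrite big_cons /= {1}/mx_entry eqxx mul1r.
move=> b; rewrite eq_sym => ub; apply: big1 => t _.
by rewrite big_cons /= {1}/mx_entry (negbTE ub) mul0r.
Qed.

Hypothesis Acyc : forall k, exists c : nat,
  {in A, forall u : {perm 'I_n}, #|[set x | iter k u x == x]| = c}.

(** The sum runs over all points of the cycle: it is the trace of a power of the
    permutation matrix, which counts the fixed points of this power. *)
Lemma entry_cum_cycle t X : t != [::] -> generic (verts X) t -> (size t + size X)%N = r ->
  #|verts (pcycle t ++ X)| = s -> (2 * s <= n)%N ->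
  entry_cum_le (sum_const (size t)) (pcycle t ++ X).
Proof.
move=> t0 gt hr hs sn; case Ek : (size t) => [|k].
  by move/eqP: Ek; rewrite size_eq0 (negbTE t0).
have [c Hc] := Acyc k.+1.
have vE : finset.set0 :|: verts X = verts X by rewrite finset.set0U.
have hc u : u \in A -> c%:R = \sum_x (iter k.+1 u x == x)%:R :> R.
  by move=> /Hc <-; rewrite -sum1_card natr_sum big_mkcond; apply: eq_bigr => x _;
     rewrite inE; case: eqP.
apply: (@entry_cum_by_summation k.+1 (@pcycle n) finset.set0 X c%:R); rewrite ?vE //.
- move=> w hw; split.
  + by rewrite -size_eq0 size_pcycle hw.
  + exact: linked_pcycle.
  + by rewrite size_pcycle hw -Ek.
  + by rewrite verts_pcycle finset.set0U.
- by move=> g w _ _; exact: relabel_pcycle.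
- move=> u uA; rewrite (hc u uA) big_words; apply: eq_bigr => x _.
  by rewrite -sum_ppath.
- rewrite cards0 expr0 mulr1 ler_nat.
  have /card_gt0P[u uA] : (0 < #|A|)%N by rewrite card_gt0.
  by rewrite -(Hc u uA) (leq_trans (max_card _)) ?card_ord.
- rewrite -hs verts_cat verts_pcycle cardsU.
  case/andP: gt => /card_uniqP ut /allP tX.
  have -> : [set x in t] :&: verts X = finset.set0.
    apply/finset.setP => x; rewrite finset.in_setI finset.in_set0 [in LHS]inE.
    by case: (boolP (x \in t)) => //= /tX /= /negbTE->.
  have -> : #|[set x in t]| = k.+1 by rewrite cardsE ut Ek.
  by rewrite cards0 subn0 addnC.
Qed.

Definition step_const : R :=
  (cum_ub r * (2 * s) ^ s)%:R + (C0 + (2 ^ r)%:R * (C0 * C0)) +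
  \sum_(k < r.+1) sum_const k.

Lemma sum_const_step k : (k <= r)%N -> sum_const k <= step_const.
Proof.
move=> hk; rewrite /step_const (bigD1 (Ordinal (hk : k < r.+1)%N)) //=.
rewrite addrCA lerDl !addr_ge0 ?mulr_ge0 ?addr_ge0 ?mulr_ge0 //.
by apply: sumr_ge0 => i _; apply: sum_const_ge0.
Qed.

Lemma entry_cum_le_weaken C D l : C <= D -> entry_cum_le C l -> entry_cum_le D l.
Proof. by move=> CD; rewrite /entry_cum_le => /le_trans; apply; rewrite ler_wpM2r. Qed.

Lemma entry_cum_le_perm C l l' : perm_eq l l' -> entry_cum_le C l' -> entry_cum_le C l.
Proof. by move=> h; rewrite /entry_cum_le (entry_cum_perm R A0 h) (verts_perm h). Qed.

(** If no two pairs share a row or a column and every second coordinate is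
    also a first one, then there is no end of a path and all pairs lie on
    cycles. *)
Lemma induction_step l : size l = r -> #|verts l| = s -> entry_cum_le step_const l.
Proof.
move=> hr hs.
have sums0 : 0 <= \sum_(k < r.+1) sum_const k.
  by apply: sumr_ge0 => i _; apply: sum_const_ge0.
have sh0 : 0 <= C0 + (2 ^ r)%:R * (C0 * C0) by rewrite addr_ge0 ?mulr_ge0.
have [hn|hn] := ltnP n (2 * s)%N.
  apply: (@entry_cum_le_weaken (cum_ub r * (2 * s) ^ s)%:R).
    by rewrite /step_const -addrA lerDl addr_ge0.
  rewrite /entry_cum_le natrM -[leLHS]mulr1; apply: ler_pM => //.
  apply: ler_pM => //.
    by rewrite -hr entry_cum_trivial.
  rewrite hs -natrX ler_nat; case: (posnP s) => [->//|s0].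
  by rewrite leq_exp2r // ltnW.
have shared (f : 'I_n * 'I_n -> 'I_n) : f = fst \/ f = snd -> ~~ uniq (map f l) ->
    entry_cum_le step_const l.
  move=> hf /non_uniq_map[p [q [X [hl fpq]]]].
  apply: (entry_cum_le_perm hl); apply: (entry_cum_le_weaken (C := C0 + (2 ^ r)%:R * (C0 * C0))).
    by rewrite /step_const addrAC lerDr addr_ge0.
  apply: entry_cum_shared; first by rewrite -hr (perm_size hl).
  by case: hf fpq => -> /eqP->; rewrite ?orbT.
have [u1|] := boolP (uniq (map fst l)); last by apply: shared; left.
have [u2|] := boolP (uniq (map snd l)); last by apply: shared; right.
have [sub|] := boolP (all [in map fst l] (map snd l)); last first.
  case/allPn => j /mapP[p pl ->] /= pj.
  have hl := perm_to_rem pl; apply: (entry_cum_le_perm hl).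
  apply: (entry_cum_le_weaken (C := sum_const 1)).
    by apply: sum_const_step; rewrite -hr (perm_size hl).
  apply: entry_cum_leaf; rewrite -?(perm_size hl) -?(verts_perm hl) //.
    by apply: contra pj => /eqP <-; exact: map_f.
  rewrite in_verts negb_or; apply/andP; split.
    by apply: contra pj => h; rewrite (perm_mem (perm_map fst hl)) inE h orbT.
  by move: u2; rewrite (perm_uniq (perm_map snd hl)) /= => /andP[].
have [l0|l0] := eqVneq l [::].
  rewrite l0 /entry_cum_le normr0 mul0r mulr_ge0 //.
  by rewrite /step_const addr_ge0 // addr_ge0.
have [t [X [t0 hl gt]]] := cycle_extraction l0 u1 u2 (allP sub).
have hsz := perm_size hl; rewrite size_cat size_pcycle hr in hsz.
apply: (entry_cum_le_perm hl); apply: (entry_cum_le_weaken (C := sum_const (size t))).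
  by apply: sum_const_step; rewrite hsz leq_addr.
by apply: entry_cum_cycle => //; rewrite -(verts_perm hl).
Qed.

End InductionStep.

(** The properties of a conjugacy class on which the estimate depends: invariance
    under conjugation, and traces of the powers of the permutation matrices
    that are the same for all elements. *)
Record conj_class_like (n : nat) (A : {set {perm 'I_n}}) : Prop := ConjClassLike {
  ccl_neq0 : A != finset.set0;
  ccl_conj : forall s t, s \in A -> (s ^ t)%g \in A;
  ccl_fix : forall k, exists c : nat,
    {in A, forall u : {perm 'I_n}, #|[set x | iter k u x == x]| = c} }.

(** The constants depend on r and on the number s of points only; as s is at
    most 2 r, the induction on s ends after finitely many steps. *)
Theorem entry_cumulants_bound (R : realFieldType) (r : nat) :
  exists2 C : R, 1 <= C & forall (n : nat) (A : {set {perm 'I_n}}) l,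
    (0 < n)%N -> conj_class_like A -> size l = r -> entry_cum_le A C l.
Proof.
elim: {r}r.+1 {-2}r (ltnSn r) => // m IHm r hr.
pose lower s (C : R) := forall (n : nat) (A : {set {perm 'I_n}}) l,
  (0 < n)%N -> conj_class_like A ->
  (size l < r)%N || (size l == r) && (#|verts l| < s)%N -> entry_cum_le A C l.
suff H s : exists2 C : R, 1 <= C & lower s C.
  have [C C1 HC] := H (2 * r).+1; exists C => // n A l n0 HA hl.
  by apply: HC => //; rewrite hl eqxx ltnS -hl card_verts_le orbT.
elim: s => [|s [C C1 HC]]; last first.
  exists (Num.max C (step_const C r s)); first by rewrite le_max C1.
  move=> n A l n0 HA hl; have [hs|hs] := boolP ((size l == r) && (#|verts l| == s)).
    case/andP: hs => /eqP h1 /eqP h2.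
    apply: (entry_cum_le_weaken (C := step_const C r s)); first by rewrite le_max lexx orbT.
    case: (HA) => A0 AJ Ac; apply: (induction_step n0 A0 AJ C1 _ _ Ac h1 h2) => u hu; [|move=> hv]; apply: HC => //.
      by rewrite hu.
    by rewrite hu eqxx hv orbT.
  apply: (entry_cum_le_weaken (C := C)); first by rewrite le_max lexx.
  apply: HC => //; move: hl hs; case: (ltngtP (size l) r) => //= _.
  by rewrite ltnS leq_eqVlt => /orP[->|->].
suff [C C1 HC] : exists2 C : R, 1 <= C & forall (n : nat) (A : {set {perm 'I_n}}) l,
    (0 < n)%N -> conj_class_like A -> (size l < r)%N -> entry_cum_le A C l.
  by exists C => // n A l n0 HA; rewrite ltn0 andbF orbF; exact: HC.
move: hr; rewrite ltnS {lower}.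
elim: r => [|r IHr] hr; first by exists 1.
have [C C1 HC] := IHr (ltnW hr); have [D D1 HD] := IHm r hr.
exists (Num.max C D); first by rewrite le_max C1.
move=> n A l n0 HA; rewrite ltnS leq_eqVlt => /orP[/eqP hl|hl].
  by apply: (entry_cum_le_weaken (C := D)); [rewrite le_max lexx orbT | apply: HD].
by apply: (entry_cum_le_weaken (C := C)); [rewrite le_max lexx | apply: HC].
Qed.

(** * Heavy spanning trees *)

Section SpanningTree.
Variables (R : realType) (r : nat).
Implicit Types (E : {set 'I_r * 'I_r}) (W : {set 'I_r}).

Record tree_on W E : Prop := TreeOn {
  tree_edges : forall p, p \in E -> [/\ (p.1 < p.2)%N, p.1 \in W & p.2 \in W];
  tree_conn : {in W &, forall a b, connect (edge_rel E) a b};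
  tree_acyclic : forall c : seq 'I_r, ucycle (edge_rel E) c -> (size c <= 2)%N }.

Definition mk_edge (u v : 'I_r) := if (u < v)%N then (u, v) else (v, u).

Lemma edge_rel_sym E : symmetric (edge_rel E).
Proof. by move=> a b; rewrite /edge_rel orbC. Qed.

Lemma edge_rel_add E u v a b :
  edge_rel (mk_edge u v |: E) a b =
  [|| edge_rel E a b, (a == u) && (b == v) | (a == v) && (b == u)].
Proof.
rewrite /edge_rel /mk_edge !inE; case: ifP => _; rewrite !xpair_eqE -!orbA;
by case: (a == u); case: (a == v); case: (b == u); case: (b == v);
  rewrite /= ?orbT ?orbF.
Qed.

(** A cycle through the new leaf v would visit u, its only neighbour, twice. *)
Lemma tree_add_leaf W E u v : tree_on W E -> u \in W -> v \notin W ->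
  tree_on (v |: W) (mk_edge u v |: E).
Proof.
move=> [hE hC hA] uW vW.
have uv : u != v by apply: contra vW => /eqP <-.
have Ev a : edge_rel E a v = false.
  by apply/negbTE/negP => /orP[] /hE[_ /= h1 h2]; rewrite ?h1 ?h2 in vW.
have Ev' a : edge_rel E v a = false by rewrite edge_rel_sym.
split=> [p|a b|c].
- rewrite !inE => /orP[/eqP->|/hE[-> -> ->]]; last by rewrite !orbT.
  rewrite /mk_edge; have [h|h] := ltnP u v; split => /=; rewrite ?eqxx ?uW ?orbT //.
  by rewrite ltn_neqAle h andbT eq_sym.
- have sub : subrel (connect (edge_rel E)) (connect (edge_rel (mk_edge u v |: E))).
    by apply: connect_sub => x y h; apply: connect1; rewrite edge_rel_add h.
  have symc : connect_sym (edge_rel (mk_edge u v |: E)).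
    exact: sym_connect_sym (edge_rel_sym _).
  have cv : connect (edge_rel (mk_edge u v |: E)) u v.
    by apply: connect1; rewrite edge_rel_add !eqxx orbT.
  have cu x : x \in v |: W -> connect (edge_rel (mk_edge u v |: E)) u x.
    by rewrite !inE => /orP[/eqP->//|xW]; apply: sub; apply: hC.
  by move=> /cu ha /cu; apply: connect_trans; rewrite symc.
- have Ew w : edge_rel (mk_edge u v |: E) v w -> w = u.
    by rewrite edge_rel_add Ev' (eq_sym v u) (negbTE uv) eqxx => /eqP.
  case/andP=> hc uc; rewrite leqNgt; apply/negP => sc.
  case: (boolP (v \in c)) => [/rot_to[i c' ec]|vc].
    have : path.cycle (edge_rel (mk_edge u v |: E)) (v :: c') by rewrite -ec rot_cycle.
    have : uniq (v :: c') by rewrite -ec rot_uniq.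
    have : (1 < size c')%N by rewrite -ltnS; move: sc; rewrite -(size_rot i) ec.
    case: c' {ec} => [|x [|y c']] //= _ /and4P[_ xyc _ _].
    rewrite rcons_path => /and3P[/Ew xu _ /andP[_]].
    rewrite edge_rel_sym => /Ew lu.
    by move: xyc; rewrite xu -lu mem_last.
  have : ucycle (edge_rel E) c; last by move/hA; rewrite leqNgt sc.
  rewrite /ucycle uc andbT; apply: (sub_in_cycle (P := predC1 v)) hc.
    move=> a b av bv; rewrite edge_rel_add => /or3P[//|/andP[_ e]|/andP[e _]].
      by rewrite inE e in bv.
    by rewrite inE e in av.
  by apply/allP => x xc; apply: contra vc => /eqP <-.
Qed.

Lemma tree_singleton a : tree_on [set a] finset.set0.
Proof.
have E0 x y : edge_rel (finset.set0 : {set 'I_r * 'I_r}) x y = false.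
  by rewrite /edge_rel !inE.
split=> [p|x y|[|x [|y c]]] //; first by rewrite inE.
  by rewrite !inE => /eqP-> /eqP->.
by rewrite /ucycle /= E0.
Qed.

(** The tree is grown by Prim's algorithm.  As long as an edge of weight 1 leaves
    W, it is used.  When there is none, W is closed under adj, and any edge out
    of W reaches a vertex with a new label; the number m of edges of small
    weight thus remains smaller than the number of labels. *)
Lemma tree_weight_grow (J : finType) (f : 'I_r -> J) (adj : rel 'I_r)
    (H : 'I_r -> 'I_r -> R) (eps : R) k :
    0 < eps <= 1 -> (forall a b, eps <= H a b) ->
    symmetric adj -> (forall a b, adj a b -> 1 <= H a b) ->
    (forall W, (forall a b, a \in W -> adj a b -> b \in W) ->
       {in W, forall a b, b \notin W -> f a != f b}) ->
    (k < r)%N ->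
  exists W E m, [/\ #|W| = k.+1, tree_on W E, (m < #|f @: W|)%N &
    eps ^+ m <= \prod_(p in E) H p.1 p.2].
Proof.
move=> /andP[e0 e1] He adjS Hadj Hf.
elim: k => [|k IH] hk.
  exists [set Ordinal hk], finset.set0, 0%N; split; rewrite ?cards1 ?imset_set1 ?cards1 //.
    exact: tree_singleton.
  by rewrite big_set0 expr0.
have [W [E [m [cW tW hm hw]]]] := IH (ltnW hk).
have H0 a b : 0 <= H a b by apply: le_trans (He a b); exact: ltW.
have [u0 u0W] : exists u, u \in W by apply/card_gt0P; rewrite cW.
have step u v j : u \in W -> v \notin W -> (j < #|f @: (v |: W)|)%N ->
    eps ^+ j <= H u v * eps ^+ m -> eps ^+ j <= H v u * eps ^+ m ->
  exists W E m, [/\ #|W| = k.+2, tree_on W E, (m < #|f @: W|)%N &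
    eps ^+ m <= \prod_(p in E) H p.1 p.2].
  move=> uW vW hj h1 h2; exists (v |: W), (mk_edge u v |: E), j; split => //.
  - by rewrite cardsU1 vW cW.
  - exact: tree_add_leaf.
  rewrite big_setU1 /=; last first.
    apply/negP => /(tree_edges tW)[_]; rewrite /mk_edge.
    by case: ifP => _ /=; rewrite (negbTE vW).
  rewrite /mk_edge; case: ifP => _ /=.
    by apply: le_trans h1 _; rewrite ler_wpM2l.
  by apply: le_trans h2 _; rewrite ler_wpM2l.
have sub v : (#|f @: W| <= #|f @: (v |: W)|)%N.
  by apply: subset_leq_card; apply: imsetS; apply: finset.subsetUr.
have [/existsP[u /existsP[v /and3P[uW vW uv]]]|/existsPn hno] :=
    boolP [exists u, exists v, [&& u \in W, v \notin W & adj u v]].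
  apply: (step u v m) => //; first exact: leq_trans hm (sub v).
    by rewrite ler_peMl ?exprn_ge0 ?Hadj // ltW.
  by rewrite ler_peMl ?exprn_ge0 ?Hadj // 1?adjS // ltW.
have Wclosed a b : a \in W -> adj a b -> b \in W.
  move=> aW ab; apply/negPn/negP => bW; have /existsPn/(_ b) := hno a.
  by rewrite aW bW ab.
have [v vW] : exists v, v \notin W.
  have : (0 < #|~: W|)%N by have := cardsC W; rewrite card_ord cW; lia.
  by case/card_gt0P => v; rewrite inE => vW; exists v.
apply: (step u0 v m.+1) => //; try by rewrite exprS ler_wpM2r ?exprn_ge0 // ltW.
apply: (@leq_trans #|f v |: f @: W|).
  rewrite cardsU1 (_ : f v \notin _) ?add1n //.
  apply/negP => /imsetP[a aW fva]; have := Hf W Wclosed a aW v vW.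
  by rewrite fva eqxx.
by rewrite finset.imsetU1.
Qed.

Lemma max_tree_weight_ge (J : finType) (f : 'I_r -> J) (adj : rel 'I_r)
    (H : 'I_r -> 'I_r -> R) (eps : R) :
    (0 < r)%N -> 0 < eps <= 1 -> (forall a b, eps <= H a b) ->
    symmetric adj -> (forall a b, adj a b -> 1 <= H a b) ->
    (forall W, (forall a b, a \in W -> adj a b -> b \in W) ->
       {in W, forall a b, b \notin W -> f a != f b}) ->
  eps ^+ #|codom f|.-1 <= max_tree_weight H.
Proof.
move=> r0 He He' adjS Hadj Hf; have r1 : (r.-1 < r)%N by rewrite prednK.
have [W [E [m [cW tW hm hw]]]] := tree_weight_grow He He' adjS Hadj Hf r1.
have WT : W = finset.setT.
  by apply/eqP; rewrite eqEcard finset.subsetT cardsT card_ord cW prednK // leqnn.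
apply: (@le_trans _ _ (eps ^+ m)).
  case/andP: He => e0 e1; apply: ler_wiXn2l; rewrite ?e1 ?(ltW e0) //.
  have -> : #|codom f| = #|f @: W|.
    by rewrite WT; apply: eq_card => x; apply/codomP/imsetP => [[a ->]|[a _ ->]]; exists a.
  by rewrite -ltnS (leq_trans hm) ?leqSpred.
apply: le_trans hw _; rewrite /max_tree_weight.
apply: (@bigmax_sup _ _ _ _ E) => //; apply/asboolP; split.
- by move=> p /(tree_edges tW)[].
- by move=> a b; apply: (tree_conn tW); rewrite WT inE.
- exact: (tree_acyclic tW).
Qed.

End SpanningTree.

(** * Cycle types *)

Section CycleType.
Variables (n : nat).
Implicit Types (s t : {perm 'I_n}).

Lemma porbit_conj s t x : porbit (s ^ t) (t x) = t @: porbit s x.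
Proof.
apply/finset.setP => y; apply/porbitP/imsetP => [[i ->]|[z /porbitP[i ->] ->]].
  by exists ((s ^+ i)%g x); [exact: mem_porbit | rewrite -conjXg permJ].
by exists i; rewrite -conjXg permJ.
Qed.

Lemma porbits_conj s t : porbits (s ^ t) = [set t @: (c : {set 'I_n}) | c in porbits s].
Proof.
apply/finset.setP => c; apply/imsetP/imsetP => [[y _ ->]|[_ /imsetP[x _ ->] ->]].
  exists (porbit s (t^-1 y)%g); first exact: imset_f.
  by rewrite -porbit_conj permKV.
by exists (t x); rewrite ?porbit_conj.
Qed.

Lemma has_cycle_type_conj lambda s t :
  has_cycle_type lambda s -> has_cycle_type lambda (s ^ t)%g.
Proof.
rewrite /has_cycle_type; apply: perm_trans.
pose h (c : {set 'I_n}) := t @: c.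
have injh : injective h by apply: imset_inj; exact: perm_inj.
apply: (perm_trans (y := [seq #|pred_of_set c| | c <- map h (enum (porbits s))])).
  apply: perm_map; apply: uniq_perm; rewrite ?enum_uniq ?map_inj_uniq ?enum_uniq // => c.
  rewrite mem_enum porbits_conj; apply/imsetP/mapP => -[d hd ->];
  by exists d => //; rewrite mem_enum in hd *.
rewrite -map_comp; rewrite (@eq_map _ _ _ (fun c : {set 'I_n} => #|c|)) // => c /=.
by rewrite card_imset //; exact: perm_inj.
Qed.

Lemma iter_fix_porbit s x k : (iter k s x == x) = (#|porbit s x| %| k)%N.
Proof.
set m := #|porbit s x|; have m0 : (0 < m)%N by rewrite lt0n card_porbit_neq0.
have E j : iter (j * m) s x = x.
  by elim: j => [//|j IH]; rewrite mulSn iterD IH iter_porbit.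
rewrite {1}(divn_eq k m) addnC iterD E /dvdn.
have := uniq_traject_porbit s x; rewrite -/m => ut.
have hr : (k %% m < m)%N by rewrite ltn_mod.
rewrite -(nth_traject s hr x) -[X in _ == X](nth_traject s m0 x).
by rewrite nth_uniq ?size_traject.
Qed.

Lemma card_fix_iter s k : #|[set x | iter k s x == x]| =
  (\sum_(m <- [seq #|pred_of_set c| | c <- enum (porbits s)]) (m %| k) * m)%N.
Proof.
rewrite big_map big_enum -sum1_card big_mkcond /=.
rewrite (partition_big (porbit s) (mem (porbits s))) /=; last first.
  by move=> x _; apply: imset_f.
apply: eq_bigr => _ /imsetP[y _ ->].
rewrite (eq_bigr (fun=> (#|porbit s y| %| k)%N : nat)); last first.
  by move=> x /eqP <-; rewrite inE iter_fix_porbit; case: (_ %| _)%N.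
rewrite sum_nat_const mulnC; congr (_ * _)%N.
by apply: eq_card => x; rewrite -eq_porbit_mem unfold_in.
Qed.

Lemma conj_class_like_cycle_type lambda :
    [set s : {perm 'I_n} | has_cycle_type lambda s] != finset.set0 ->
  conj_class_like [set s : {perm 'I_n} | has_cycle_type lambda s].
Proof.
move=> h0; split=> // [s t|k]; first by rewrite !inE; apply: has_cycle_type_conj.
exists (\sum_(m <- lambda) (m %| k) * m)%N => s; rewrite inE => hs.
by rewrite card_fix_iter (perm_big _ hs).
Qed.
End CycleType.

(** * The spanning tree of a multiset of pairs *)

Section PsiTree.
Variables (R : realType) (n r : nat) (v : r.-tuple ('I_n * 'I_n)).
Hypotheses (n0 : (0 < n)%N) (r0 : (0 < r)%N).
Local Notation alpha := (seq_mset v).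
Local Notation e := (pair_rel alpha).

Lemma mem_alpha p : (p \in alpha) = (p \in (v : seq _)).
Proof. by rewrite in_mset mset_seqE -has_count has_pred1. Qed.

Lemma pair_rel_sym : symmetric e.
Proof. by move=> x y; rewrite /pair_rel orbC. Qed.

Lemma pair_rel_verts x y : e x y -> x \in verts v.
Proof.
by rewrite /pair_rel !mem_alpha in_verts => /orP[] h; apply/orP; [left|right];
  [apply: (map_f fst h) | apply: (map_f snd h)].
Qed.

Lemma support_ptsE : support_pts alpha = verts v.
Proof.
apply/finset.setP => x; rewrite inE; apply/existsP/idP => [[y /pair_rel_verts]//|].
rewrite in_verts => /orP[] /mapP[[a b] h ->]; [exists b | exists a];
by rewrite /pair_rel !mem_alpha h ?orbT.
Qed.

Definition label (a : 'I_r) := fingraph.root e (tnth v a).1.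

Lemma label_card : (#|codom label| <= CC alpha)%N.
Proof.
rewrite /CC /n_comp_mem; apply: subset_leq_card; apply/fintype.subsetP => _ /codomP[a ->].
have syme : connect_sym e := sym_connect_sym pair_rel_sym.
apply/andP; split; first exact: roots_root.
change (label a \in support_pts alpha); rewrite support_ptsE.
have cl : fingraph.closed e (verts v).
  by apply: intro_closed => // x y; rewrite pair_rel_sym => /pair_rel_verts.
have := closed_connect cl (connect_root e (tnth v a).1); rewrite -/(label a) => <-.
by rewrite in_verts map_f // mem_tnth.
Qed.

Definition touches (a b : 'I_r) :=
  ~~ [disjoint [set (tnth v a).1; (tnth v a).2] & [set (tnth v b).1; (tnth v b).2]].

Lemma touches_sym : symmetric touches.
Proof. by move=> a b; rewrite /touches disjoint_sym. Qed.

(** A set of pairs that is closed under sharing a point covers a union of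
    components. *)
Lemma label_separates (W : {set 'I_r}) :
    (forall a b, a \in W -> touches a b -> b \in W) ->
  {in W, forall a b, b \notin W -> label a != label b}.
Proof.
move=> HW a aW b bW; rewrite root_connect; last exact: sym_connect_sym pair_rel_sym.
pose S := [set x | [exists c in W, x \in [set (tnth v c).1; (tnth v c).2]]].
have SW c x : x \in S -> x \in [set (tnth v c).1; (tnth v c).2] -> c \in W.
  rewrite inE => /exists_inP[d dW xd] xc; apply: HW dW _.
  by apply/pred0Pn; exists x; rewrite /= xd.
have cl : fingraph.closed e S.
  apply: intro_closed => [|x y]; first exact: sym_connect_sym pair_rel_sym.
  rewrite /pair_rel !mem_alpha => exy xS.
  have [c xc yc] : exists2 c, x \in [set (tnth v c).1; (tnth v c).2] &
                              y \in [set (tnth v c).1; (tnth v c).2].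
    by case/orP: exy => /tnthP[c hc]; exists c; rewrite -hc !inE eqxx ?orbT.
  by rewrite inE; apply/exists_inP; exists c => //; apply: SW xS xc.
apply/negP => /(closed_connect cl) h; case/negP: bW.
apply: (SW _ (tnth v b).1); last by rewrite !inE eqxx.
by rewrite -h inE; apply/exists_inP; exists a => //; rewrite !inE eqxx.
Qed.

(** Labelling a pair by its component, the tree has at most CC - 1 edges of
    weight 1/n, which cancels n^CC in Psi up to one factor n. *)
Lemma Psi_tree_weight_ge :
  n%:R / n%:R ^+ #|verts v| <=
    @Psi n R alpha * max_tree_weight (wg_induced (@perm_weight n R) v).
Proof.
have n1 : 1 <= n%:R :> R by rewrite ler1n.
have np : 0 < n%:R :> R by rewrite ltr0n.
have nv1 : (n%:R : R)^-1 <= 1 by rewrite invf_le1.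
have HM := @max_tree_weight_ge R r _ label touches
  (wg_induced (@perm_weight n R) v) n%:R^-1 r0 _ _ touches_sym _ label_separates.
apply: (@le_trans _ _ (@Psi n R alpha * n%:R^-1 ^+ #|codom label|.-1)); last first.
  apply: ler_wpM2l; first by rewrite /Psi exprz_ge0.
  apply: HM => [|a b|a b]; first by rewrite invr_gt0 np.
    by rewrite /wg_induced /perm_weight; case: ifP.
  by rewrite /wg_induced /perm_weight /touches => /negbTE->.
have c0 : (0 < #|codom label|)%N.
  by apply/card_gt0P; exists (label (Ordinal r0)); apply: codom_f.
rewrite /Psi support_ptsE expfzDr ?lt0r_neq0 // exprnN -exprnP exprVn.
rewrite mulrAC ler_wpM2r ?invr_ge0 ?exprn_ge0 // ler_pdivlMr ?exprn_gt0 //.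
rewrite -exprS prednK //; apply: ler_weXn2l => //; exact: label_card.
Qed.
End PsiTree.

(** * Expectations under the uniform law on a finite set *)

Section UniformLaw.
Context (d : measure_display) (T : measurableType d) (R : realType).
Variables (P : probability T R) (F : finType) (A : {set F}) (X : T -> F).
Hypothesis HX : uniform_on P A X.
Local Open Scope classical_set_scope.

Lemma uniform_measurable (B : set F) : measurable (X @^-1` B).
Proof.
have -> : X @^-1` B = \bigcup_(x in B) (X @^-1` [set x]).
  by apply/seteqP; split=> [t Bt|t [x Bx /= Xt]]; [by exists (X t)|by rewrite /= Xt].
apply: fin_bigcup_measurable => [|x _]; first exact: finite_finset.
by have [] := HX x.
Qed.

Lemma uniform_measurable_fun (g : F -> R) : measurable_fun setT (fun t => g (X t)).
Proof. by move=> _ Y _; rewrite setTI; exact: (uniform_measurable (g @^-1` Y)). Qed.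

Lemma uniform_decomposition (g : F -> R) t :
  (g (X t))%:E = (\sum_(x : F) (g x)%:E * (\1_(X @^-1` [set x]) t)%:E)%E.
Proof.
rewrite (bigD1 (X t)) //= indicE mem_set // mule1 big1 ?adde0 // => x xX.
rewrite indicE memNset ?mule0 // => /= e.
by rewrite -e eqxx in xX.
Qed.

Lemma uniform_integrable (g : F -> R) :
  P.-integrable setT (fun t => (g (X t))%:E).
Proof.
have -> : (fun t => (g (X t))%:E) =
    (fun t => \sum_(x : F) (g x)%:E * (\1_(X @^-1` [set x]) t)%:E)%E.
  by apply/funext => t; exact: uniform_decomposition.
apply: integrable_sum => // x _; apply: integrableZl => //.
by apply: integrable_indic => //; have [] := HX x.
Qed.

Lemma uniform_expectation (g : F -> R) :
  fine ('E_P[fun t => g (X t)])%E = (\sum_(x in A) g x) / #|A|%:R.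
Proof.
rewrite unlock.
under eq_integral do rewrite uniform_decomposition.
have int x : P.-integrable setT (fun t => (\1_(X @^-1` [set x]) t)%:E).
  by apply: integrable_indic => //; have [] := HX x.
rewrite integral_sum //; last by move=> x; apply: integrableZl.
rewrite (eq_bigr (fun x => (g x * (if x \in A then #|A|%:R^-1 else 0))%:E)); last first.
  move=> x _; have [mx Px] := HX x.
  rewrite integralZl // integral_indic // setIT EFinM; congr (_ * _)%E.
  exact: Px.
rewrite sumEFin /= mulr_suml [RHS]big_mkcond /=; apply: eq_bigr => x _.
by case: ifP; rewrite ?mulr0.
Qed.

End UniformLaw.

Section CumulantLink.
Context (d : measure_display) (T : measurableType d) (R : realType).
Variables (P : probability T R) (n : nat) (A : {set {perm 'I_n}}).
Variable sigma : T -> {perm 'I_n}.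
Hypothesis (Hs : uniform_on P A sigma) (A0 : A != finset.set0).

Lemma moment_series_list r (f : 'I_r -> {perm 'I_n} -> R) (l : seq 'I_r) : uniq l ->
  fps_list (moment_series P (fun a t => f a (sigma t))) l = mom (avg A) (map f l).
Proof.
move=> ul; rewrite /fps_list /moment_series /mom /= /avg.
rewrite -(uniform_expectation Hs (fun s => (\prod_(v <- map f l) v) s)).
congr (fine ('E_P[_])%E); apply/funext => t.
have := fps_exp_lin_list (fun a => f a (sigma t)) ul; rewrite /fps_list => ->.
by rewrite fct_prodE big_map.
Qed.

Lemma cumulant_entry_cum r (v : r.-tuple ('I_n * 'I_n)) : (0 < r)%N ->
  cumulant P (fun a => perm_indicator R sigma (tnth v a)) = entry_cum R A v.
Proof.
move=> r0; pose f a := @mx_entry R n (tnth v a).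
have -> : cumulant P (fun a => perm_indicator R sigma (tnth v a)) =
    fps_list (fps_log (moment_series P (fun a t => f a (sigma t)))) (enum 'I_r).
  rewrite /cumulant /fps_list; congr (fps_log _ _); apply/ffunP => i.
  by rewrite !ffunE inE mem_enum.
rewrite fps_log_list ?enum_uniq //.
have vE : (v : seq _) = map (tnth v) (enum 'I_r) by rewrite map_tnth_enum.
case E : (enum 'I_r) => [|i l].
  by have := size_enum_ord r; rewrite E => /= r1; rewrite -r1 in r0.
rewrite vE E /= (conv_log_cum (f := f) (avg1 R A0)) //.
- by rewrite -map_comp.
- by move=> s us; exact: moment_series_list.
- by rewrite -E enum_uniq.
Qed.
End CumulantLink.

Theorem theorem3 (R : realType) :
  exists C : nat -> R,
    (forall r : nat, (0 < r)%N -> 0 < C r) /\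
    forall (n : nat) (lambda : seq nat),
      (0 < n)%N -> is_partition n lambda ->
      forall (d : measure_display) (T : measurableType d)
        (P : probability T R) (sigma : T -> {perm 'I_n}),
        uniform_on P [set s : {perm 'I_n} | has_cycle_type lambda s]%SET sigma ->
        weighted_dependency_graph P (@Psi n R) C
          (perm_indicator R sigma) (@perm_weight n R).
Proof.
have /choice[C HC] : forall r, exists c : R, 1 <= c /\
    forall (n : nat) (A : {set {perm 'I_n}}) l,
    (0 < n)%N -> conj_class_like A -> size l = r -> entry_cum_le A c l.
  by move=> r; have [c c1 hc] := entry_cumulants_bound R r; exists c.
exists C; split=> [r _|n lambda n0 _ d T P sigma Hs].
  by apply: lt_le_trans (HC r).1.
set A := [set s | _]%SET in Hs *.
have A0 : A != finset.set0.
  apply/eqP => A0; have := uniform_expectation Hs (fun=> 1).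
  by rewrite A0 big_set0 mul0r expectation_cst /= => /eqP; rewrite oner_eq0.
have HA : conj_class_like A by exact: conj_class_like_cycle_type.
split.
- split=> [u v|u v]; rewrite /perm_weight; first by rewrite disjoint_sym.
  by case: ifP => _; rewrite ?lexx ?ler01 // invr_ge0 ler0n /= invf_le1 ?ler1n // ltr0n.
- move=> p; split; first exact: (uniform_measurable_fun Hs (fun s => (s p.1 == p.2)%:R)).
  by move=> k; exact: (uniform_integrable Hs (fun s => (s p.1 == p.2)%:R ^+ k)).
move=> r v r0; rewrite (cumulant_entry_cum Hs A0 v r0) -mulrA.
have [C1 /(_ n A v n0 HA (size_tuple v))] := HC r.
rewrite /entry_cum_le -ler_pdivlMr ?exprn_gt0 ?ltr0n // -mulrA => h.
apply: le_trans h _; rewrite ler_wpM2l ?(le_trans _ C1) //.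
exact: Psi_tree_weight_ge.
Qed.
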